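(* Suppose that $1<p<\infty$. There exists a constant $\rho>0$, depending only on $p$, such that the following holds: if $f \in H^p$ is an inner function with $f(0)\neq 0$ and $q_{1,p}[f](z) = a(z-w)$ for some $a,w\in\mathbb{C}$, then $|w|\geq \rho$.
   Context: $H^p$ denotes the classical Hardy space of holomorphic functions on the open unit disk $\mathbb{D}$, with norm $\|f\|_p = \left(\sup_{0\le r<1}\frac{1}{2\pi}\int_0^{2\pi}|f(re^{i\theta})|^p\,d\theta\right)^{1/p}$. For an integer $n\ge 0$ let $\mathcal{P}_n$ be the set of complex polynomials of degree at most $n$. For $1<p<\infty$ and $f\in H^p$, not identically zero, the $n$-th optimal polynomial approximant (OPA) to $1/f$ in $H^p$, denoted $q_{n,p}[f]$, is the unique polynomial $q\in\mathcal{P}_n$ minimizing $\|1-qf\|_p$ over $\mathcal{P}_n$. An inner function is a bounded holomorphic function on $\mathbb{D}$ whose radial boundary values have modulus $1$ almost everywhere on the unit circle. *)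

(* Defs.v *)
From mathcomp Require Import all_boot all_order all_algebra.
From mathcomp Require Import complex.
From mathcomp Require Import all_classical all_reals all_analysis.

Set Implicit Arguments.
Unset Strict Implicit.
Unset Printing Implicit Defensive.

Import Order.TTheory GRing.Theory Num.Theory.
Import numFieldNormedType.Exports.

Local Open Scope classical_set_scope.
Local Open Scope ring_scope.

(* The norm `|z| of R[i] takes its values in R[i]; this is the real-valued one. *)
Definition cabs (R : realType) (z : R[i]) : R := ComplexField.Normc.normc z.

Definition circle_pt (R : realType) (r t : R) : R[i] :=
  Complex (r * cos t) (r * sin t).

(* Functions on the open unit disk are total functions of which only the
   values on the disk matter. *)
Definition holomorphic_on_disk (R : realType) (f : R[i] -> R[i]) : Prop :=
  forall z : R[i], cabs z < 1 -> derivable (f : R[i]^o -> R[i]^o) z 1.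

Definition integral_mean (R : realType) (p : R) (f : R[i] -> R[i]) (r : R) :
    \bar R :=
  (((2 * pi)^-1)%:E *
    \int[lebesgue_measure]_(t in `[0%R, (2 * pi)%R]) (cabs (f (circle_pt r t)) `^ p)%:E)%E.

Definition Hp_norm (R : realType) (p : R) (f : R[i] -> R[i]) : \bar R :=
  (ereal_sup [set integral_mean p f r | r in [set r : R | (0 <= r < 1)%R]] `^ p^-1)%E.

Definition in_Hp (R : realType) (p : R) (f : R[i] -> R[i]) : Prop :=
  holomorphic_on_disk f /\ (Hp_norm p f < +oo)%E.

Definition inner_function (R : realType) (f : R[i] -> R[i]) : Prop :=
  [/\ holomorphic_on_disk f,
      exists M : R, forall z : R[i], cabs z < 1 -> cabs (f z) <= M
    & {ae @lebesgue_measure R, forall t, `[0%R, 2 * pi]%classic t ->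
        exists2 l : R[i],
          (f (circle_pt r t) : R[i]^o) @[r --> (1 : R)^'-] --> (l : R[i]^o)
        & cabs l = 1}].

Definition opa_error (R : realType) (p : R) (f : R[i] -> R[i])
    (q : {poly R[i]}) : \bar R :=
  Hp_norm p (fun z => 1 - q.[z] * f z).

(* By strict convexity of the norm there is exactly one such q when 1 < p and
   f is a nonzero element of H^p. *)
Definition is_opa (R : realType) (n : nat) (p : R) (f : R[i] -> R[i])
    (q : {poly R[i]}) : Prop :=
  (size q <= n.+1)%N /\
  forall q' : {poly R[i]}, (size q' <= n.+1)%N ->
    (opa_error p f q <= opa_error p f q')%E.

(* Main.v *)
Require Import Defs.
From mathcomp Require Import all_boot all_order all_algebra.
From mathcomp Require Import complex.
From mathcomp Require Import all_classical all_reals all_analysis.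
From mathcomp Require Import ring lra.
Import Order.TTheory GRing.Theory Num.Theory.
Import numFieldNormedType.Exports.
Local Open Scope ring_scope.

(** Write c = f 0, let q = a (z - w) be optimal, and put h = - q f, so that the
    error is the L^p mean of |1 + h|. The theorem compares two estimates of
    that error, both of second order.

    From above, the constant competitor q = e (conj c), with a small e > 0
    depending only on p, gives error^p <= 1 - b |c|^2 ([constant_error_le]):
    the linear term of |1 + h|^p has circle mean p Re (h 0), by the mean value
    property, and the quadratic term is controlled because |f| <= 1.

    From below, h 0 = a w c, so the linear term for q itself is at least
    - p |a| |w| |c|, while the convexity of s^p contributes a quadratic term
    k |a|^2, because |z - w| is bounded below near the circle (once |w| <= 1/4)
    and |f| has mean square close to 1 there ([linear_error_ge]).

    Together, b |c|^2 + k |a|^2 <= p |a| |w| |c| with c nonzero, and since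
    2 |a| |c| <= |a|^2 + |c|^2 this bounds |w| below by 2 (min b k) / p, which
    depends on p only.

    The pointwise inequalities for |1 + h|^p reduce to one real variable
    through |h|^2 = (s - 1)^2 + 2 (s - 1 - Re h) with s = |1 + h|
    ([sqr_cabs_decomp]). The complex analysis is built from Goursat's bisection
    argument ([boundary_integral_eq0]), in the form: a weighted 1-form
    F (l dx + k dy) on a rectangle whose coefficient satisfies
    dF = D (l dx + k dy) has zero boundary integral. Contracting a circle to a
    point z inside it along segments turns this into Cauchy's formula
    ([cauchy_formula]). Applied to the powers f^n, whose moments on circles are
    bounded independently of n by dominated convergence ([inner_moments]), the
    formula shows |f| <= 1 on the disk ([inner_function_le1]). *)

Set Implicit Arguments.
Unset Strict Implicit.
Unset Printing Implicit Defensive.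

(** * Quadratic bounds for |1 + h|^p *)

Lemma cabs_ge0 (R : realType) (z : R[i]) : 0 <= cabs z.
Proof. by case: z => a b; rewrite /cabs /= sqrtr_ge0. Qed.

Lemma sqr_cabs (R : realType) (z : R[i]) :
  cabs z ^+ 2 = complex.Re z ^+ 2 + complex.Im z ^+ 2.
Proof. by case: z => a b; rewrite /cabs /= sqr_sqrtr// addr_ge0// sqr_ge0. Qed.

Lemma ger_Re_cabs (R : realType) (z : R[i]) : `|complex.Re z| <= cabs z.
Proof.
rewrite -(ler_pXn2r (n := 2)) ?nnegrE ?normr_ge0 ?cabs_ge0//.
by rewrite sqr_cabs real_normK ?num_real// lerDl sqr_ge0.
Qed.

Lemma ger_Im_cabs (R : realType) (z : R[i]) : `|complex.Im z| <= cabs z.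
Proof.
rewrite -(ler_pXn2r (n := 2)) ?nnegrE ?normr_ge0 ?cabs_ge0//.
by rewrite sqr_cabs real_normK ?num_real// lerDr sqr_ge0.
Qed.

(** Young's inequality for the pair s, m^(p-1), rearranged. *)
Lemma powR_tangent (R : realType) (p m s : R) : 1 < p -> 0 <= m -> 0 <= s ->
  m `^ p + p * m `^ (p - 1) * (s - m) <= s `^ p.
Proof.
move=> p1 m0 s0; have p0 : 0 < p by lra.
have q0 : 0 < p / (p - 1) by rewrite divr_gt0//; lra.
have pq : p^-1 + (p / (p - 1))^-1 = 1 by field; apply/andP; split; lra.
have := conjugate_powR s0 (powR_ge0 m (p - 1)) p0 q0 pq.
rewrite -powRrM (_ : (p - 1) * (p / (p - 1)) = p); last by field; lra.
rewrite -(ler_pM2l p0) (_ : p * (_ / p + _) = s `^ p + (p - 1) * m `^ p); last first.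
  by field; apply/andP; split; lra.
have := mulr_powRB1 m0 p0.
set u := m `^ (p - 1); set v := m `^ p; set w := s `^ p.
by move=> <-; nra.
Qed.

Lemma ln_le_subr1 (R : realType) (x : R) : 0 < x -> ln x <= x - 1.
Proof. by move=> x0; rewrite -{1}(subrKC 1 x) le_ln1Dx//; lra. Qed.

Lemma subr1V_le_ln (R : realType) (x : R) : 0 < x -> 1 - x^-1 <= ln x.
Proof.
move=> x0; have := @ln_le_subr1 R x^-1; rewrite lnV ?posrE// invr_gt0.
by move=> /(_ x0); lra.
Qed.

Lemma powR_ge1D (R : realType) (x r : R) : 0 < x -> 1 + r * ln x <= x `^ r.
Proof. by move=> x0; rewrite /powR gt_eqF// expR_ge1Dx. Qed.

(** A quantitative monotonicity of m^q: for m >= 1 use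
    m^q >= 1 + q ln m with ln m >= 1 - 1/m, for m < 1 use the same bound for
    the exponent -q. Both slopes are at least q / (S (1 + q)). *)
Lemma powRB1_ge (R : realType) (q m S : R) : 0 < q -> 0 < m <= S -> 1 <= S ->
  q / (S * (1 + q)) * (m - 1) ^+ 2 <= (m `^ q - 1) * (m - 1).
Proof.
move=> q0 /andP[m0 mS] S1.
rewrite mulrAC ler_pdivrMr; last by nra.
have [m1|m1] := leP 1 m.
  have mq : q * (m - 1) <= m * (m `^ q - 1).
    have h1 := @powR_ge1D R m q m0; have h2 := subr1V_le_ln m0.
    have mV : m * m^-1 = 1 by rewrite divff// gt_eqF.
    have h3 : q * (m * (1 - m^-1)) <= q * (m * ln m) by rewrite !ler_pM2l.
    have h4 : m * (1 + q * ln m) <= m * m `^ q by rewrite ler_pM2l.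
    by nra.
  have h0 : 0 <= (m `^ q - 1) by nra.
  have h1 : m * (m `^ q - 1) <= (S * (1 + q)) * (m `^ q - 1).
    by rewrite ler_wpM2r//; nra.
  by rewrite expr2 mulrA [leRHS]mulrAC ler_wpM2r//; lra.
have h1 := @powR_ge1D R m (- q) m0; have h2 := ln_le_subr1 m0.
have h3 : q * ln m <= q * (m - 1) by rewrite ler_pM2l.
have u0 : 0 < m `^ q by rewrite powR_gt0.
rewrite powRN in h1.
have h4 : m `^ q * (1 + q * (1 - m)) <= 1.
  rewrite mulrC -ler_pdivlMr// div1r; lra.
set u := m `^ q in u0 h4 *.
have x0 : 0 <= q * (1 - m) by rewrite mulr_ge0//; lra.
have h7 : 0 <= 1 - u by nra.
have h5 : q * (1 - m) <= (1 - u) * (1 + q).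
  apply: (@le_trans _ _ ((1 - u) * (1 + q * (1 - m)))); first by nra.
  by rewrite ler_wpM2l//; nra.
have h8 : 0 <= (1 - u) * (1 - m) by rewrite mulr_ge0//; lra.
have h6 : q * (1 - m) ^+ 2 <= (1 - u) * (1 + q) * (1 - m).
  by rewrite expr2 mulrA ler_wpM2r//; lra.
have h9 : (1 - u) * (1 - m) * (1 + q) <= (1 - u) * (1 - m) * (S * (1 + q)).
  by rewrite ler_wpM2l//; nra.
nra.
Qed.

Lemma powRB1_le (R : realType) (q s : R) : 0 < q -> 2^-1 <= s <= 2 ->
  (s `^ q - 1) * (s - 1) <= q * (2 `^ q + 2) * (s - 1) ^+ 2.
Proof.
move=> q0 /andP[s2 s2']; have s0 : 0 < s by lra.
have u0 := powR_gt0 q s0; have v0 := @powR_gt0 R 2 q ltac:(lra).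
have [s1|s1] := leP 1 s.
  have h1 := @powR_ge1D R s (- q) s0; have h2 := ln_le_subr1 s0.
  have h3 : q * ln s <= q * (s - 1) by rewrite ler_pM2l.
  have uv : s `^ q <= 2 `^ q by rewrite ge0_ler_powR ?nnegrE//; lra.
  have h4 : s `^ q * (1 - q * (s - 1)) <= 1.
    rewrite mulrC -ler_pdivlMr// div1r -powRN; lra.
  have h5 : s `^ q * (q * (s - 1)) <= 2 `^ q * (q * (s - 1)).
    by rewrite ler_wpM2r// mulr_ge0//; lra.
  have h7 : 0 <= q * (s - 1) by rewrite mulr_ge0//; lra.
  have h6 : s `^ q - 1 <= q * (2 `^ q + 2) * (s - 1) by nra.
  by rewrite expr2 mulrA ler_wpM2r//; lra.
have h1 := @powR_ge1D R s q s0; have h2 := subr1V_le_ln s0.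
have sV : s^-1 - 1 <= 2 * (1 - s).
  by rewrite -(ler_pM2l s0) mulrBr divff ?gt_eqF//; nra.
have h3 : q * (s^-1 - 1) <= q * (2 * (1 - s)) by rewrite ler_pM2l.
have h4 : q * (1 - s^-1) <= q * ln s by rewrite ler_pM2l.
have h7 : 0 <= 2 `^ q * (q * (1 - s)) by rewrite !mulr_ge0//; lra.
have h6 : 1 - s `^ q <= q * (2 `^ q + 2) * (1 - s) by nra.
nra.
Qed.

(** Strong convexity without second derivatives: follow the tangent at 1 up
    to the midpoint m of 1 and s, then the tangent at m up to s. The gain over
    the tangent at 1 is p (m^(p-1) - 1) (m - 1), which is quadratic in s - 1.
    The bound k <= p / 2 is what the passage to complex h requires. *)
Lemma powR_ge_quadratic (R : realType) (p S : R) : 1 < p -> 1 <= S ->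
  exists2 k : R, 0 < k <= p / 2 & forall s, 0 <= s <= S ->
    1 + p * (s - 1) + k * (s - 1) ^+ 2 <= s `^ p.
Proof.
move=> p1 S1; set c := (p - 1) / (S * (1 + (p - 1))).
have c0 : 0 < c by rewrite divr_gt0//; [lra|rewrite mulr_gt0//; lra].
exists (Num.min (p * c / 4) (p / 2)).
  have pc0 : 0 < p * c by rewrite mulr_gt0//; lra.
  by rewrite lt_min ge_min lexx orbT andbT; apply/andP; split; lra.
move=> s /andP[s0 sS]; set m := (1 + s) / 2.
have m0 : 0 < m by rewrite /m; lra.
have mS : m <= S by rewrite /m; lra.
have h1 := powR_tangent p1 (ltW m0) s0.
have h2 := powR_tangent p1 ler01 (ltW m0).
have h3 := @powRB1_ge R (p - 1) m S ltac:(lra) ltac:(lra) S1.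
rewrite !powR1 in h2; rewrite -/c in h3.
have sm : s = 2 * m - 1 by rewrite /m; lra.
have h4 : Num.min (p * c / 4) (p / 2) * (s - 1) ^+ 2 <= p * c / 4 * (s - 1) ^+ 2.
  by rewrite ler_wpM2r ?sqr_ge0// ge_min lexx.
rewrite sm in h1 h4 *.
set u := m `^ (p - 1) in h1 h3; set v := m `^ p in h1 h2.
set w := _ `^ p in h1 *.
have h5 : p * (c * (m - 1) ^+ 2) <= p * ((u - 1) * (m - 1)).
  by rewrite ler_pM2l//; lra.
nra.
Qed.

(** The tangent at s, evaluated at 1, bounds s^p from above by
    1 + p s^(p-1) (s - 1). The bound p / 2 <= K is what the passage to complex
    h requires. *)
Lemma powR_le_quadratic (R : realType) (p : R) : 1 < p ->
  exists2 K : R, p / 2 <= K & forall s, 2^-1 <= s <= 2 ->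
    s `^ p <= 1 + p * (s - 1) + K * (s - 1) ^+ 2.
Proof.
move=> p1; set c := (p - 1) * (2 `^ (p - 1) + 2).
exists (Num.max (p * c) (p / 2)); first by rewrite le_max lexx orbT.
move=> s sI; have [s2 s2'] := andP sI.
have h1 := powR_tangent p1 (ltac:(lra) : 0 <= s) ler01.
have h2 := @powRB1_le R (p - 1) s ltac:(lra) sI.
have h4 : p * c * (s - 1) ^+ 2 <= Num.max (p * c) (p / 2) * (s - 1) ^+ 2.
  by rewrite ler_wpM2r ?sqr_ge0// le_max lexx.
rewrite -/c in h2; rewrite !powR1 in h1.
set u := s `^ (p - 1) in h1 h2 *; set w := s `^ p in h1 *.
have h5 : p * ((u - 1) * (s - 1)) <= p * (c * (s - 1) ^+ 2).
  by rewrite ler_pM2l//; lra.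
nra.
Qed.

(** Both terms on the right are nonnegative, and the second is linear in
    |1 + h|; so quadratic bounds for s^p in s - 1 become quadratic bounds for
    |1 + h|^p in |h|, with the linear term p (s - 1) exchanged for p Re h. *)
Lemma sqr_cabs_decomp (R : realType) (h : R[i]) :
  cabs h ^+ 2 = (cabs (1 + h) - 1) ^+ 2 + 2 * (cabs (1 + h) - 1 - complex.Re h).
Proof.
rewrite [X in _ = X](_ : _ = cabs (1 + h) ^+ 2 - 1 - 2 * complex.Re h); last by ring.
by rewrite !sqr_cabs; case: h => a b /=; ring.
Qed.

Lemma Re_le_cabs1D (R : realType) (h : R[i]) : complex.Re h <= cabs (1 + h) - 1.
Proof.
have := ger_Re_cabs (1 + h); have := ler_norm (complex.Re (1 + h)).
by case: h => a b /=; lra.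
Qed.

Lemma cabs_powR_ge (R : realType) (p S : R) : 1 < p -> 1 <= S ->
  exists2 k : R, 0 < k & forall h : R[i], cabs (1 + h) <= S ->
    1 + p * complex.Re h + k * cabs h ^+ 2 <= cabs (1 + h) `^ p.
Proof.
move=> p1 S1; have [k /andP[k0 kp] H] := @powR_ge_quadratic R p S p1 S1.
exists k => // h hS; have := H _ (introT andP (conj (cabs_ge0 _) hS)).
have := Re_le_cabs1D h; rewrite sqr_cabs_decomp; nra.
Qed.

Lemma cabs_powR_le (R : realType) (p : R) : 1 < p ->
  exists2 K : R, 0 < K & forall h : R[i], 2^-1 <= cabs (1 + h) <= 2 ->
    cabs (1 + h) `^ p <= 1 + p * complex.Re h + K * cabs h ^+ 2.
Proof.
move=> p1; have [K Kp H] := @powR_le_quadratic R p p1.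
exists K => [|h /H]; first lra.
have := Re_le_cabs1D h; rewrite sqr_cabs_decomp; nra.
Qed.

(** * The modulus *)

Lemma cabsM (R : realType) (x y : R[i]) : cabs (x * y) = cabs x * cabs y.
Proof. exact: ComplexField.Normc.normcM. Qed.

Lemma cabsD (R : realType) (x y : R[i]) : cabs (x + y) <= cabs x + cabs y.
Proof. exact: le_normcD. Qed.

Lemma cabsN (R : realType) (x : R[i]) : cabs (- x) = cabs x.
Proof. exact: normcN. Qed.

Lemma cabsC (R : realType) (x y : R[i]) : cabs (x - y) = cabs (y - x).
Proof. by rewrite -cabsN opprB. Qed.

Lemma cabsB (R : realType) (x y : R[i]) : cabs (x - y) <= cabs x + cabs y.
Proof. by rewrite (le_trans (cabsD _ _))// cabsN. Qed.

Lemma cabs_real (R : realType) (r : R) : cabs (r%:C)%C = `|r|.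
Proof. by rewrite /cabs /= expr0n addr0 sqrtr_sqr. Qed.

Lemma cabs0 (R : realType) : cabs (0 : R[i]) = 0.
Proof. by rewrite -[0]/(0%:C)%C cabs_real normr0. Qed.

Lemma cabs1 (R : realType) : cabs (1 : R[i]) = 1.
Proof. by rewrite -[1]/(1%:C)%C cabs_real normr1. Qed.

Lemma cabs_i (R : realType) : cabs ('i%C : R[i]) = 1.
Proof. by rewrite /cabs /= expr0n expr1n add0r sqrtr1. Qed.

Lemma cabs_eq0 (R : realType) (z : R[i]) : cabs z = 0 -> z = 0.
Proof. exact: ComplexField.Normc.eq0_normc. Qed.

Lemma cabs_gt0 (R : realType) (z : R[i]) : z != 0 -> 0 < cabs z.
Proof.
move=> z0; rewrite lt_neqAle cabs_ge0 andbT eq_sym.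
by apply: contra z0 => /eqP /cabs_eq0 ->.
Qed.

Lemma cabsX (R : realType) (z : R[i]) n : cabs (z ^+ n) = cabs z ^+ n.
Proof. by elim: n => [|n IH]; rewrite ?cabs1// !exprS cabsM IH. Qed.

Lemma cabsV (R : realType) (z : R[i]) : cabs z^-1 = (cabs z)^-1.
Proof. exact: ComplexField.Normc.normcV. Qed.

Lemma cabs_le_ReIm (R : realType) (z : R[i]) :
  cabs z <= `|complex.Re z| + `|complex.Im z|.
Proof.
rewrite -(ler_pXn2r (n := 2)) ?nnegrE ?addr_ge0 ?cabs_ge0//.
rewrite sqr_cabs sqrrD !real_normK ?num_real// addrAC lerDl.
by rewrite mulrn_wge0// mulr_ge0.
Qed.

Lemma ler_dist_cabs (R : realType) (x y : R[i]) :
  `|cabs x - cabs y| <= cabs (x - y).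
Proof.
have := cabsD (x - y) y; have := cabsD (y - x) x.
by rewrite !subrK (cabsC y x) ler_norml => *; apply/andP; split; lra.
Qed.

(** * Continuity of complex functions of a real variable *)

(** Continuity phrased with the real-valued modulus, so that the estimates
    below never leave the ordered field R. *)
Definition ccontinuous_at (R : realType) (u : R -> R[i]) (x : R) :=
  forall e : R, 0 < e -> exists2 d : R, 0 < d &
    forall y, `|y - x| < d -> cabs (u y - u x) <= e.

Lemma lip_continuous (R : realType) (phi : R[i] -> R) (u : R -> R[i]) x :
  (forall z w, `|phi z - phi w| <= cabs (z - w)) ->
  ccontinuous_at u x -> {for x, continuous (fun t => phi (u t))}.
Proof.
move=> lip ux; apply/cvgrPdist_le => /= e /ux[d d0 H].
near=> y; apply: (le_trans (lip _ _)); rewrite cabsC; apply: H.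
rewrite distrC; near: y; exact: cvgr_dist_lt.
Unshelve. all: by end_near. Qed.

Lemma continuous_Re (R : realType) (u : R -> R[i]) x :
  ccontinuous_at u x -> {for x, continuous (fun t => complex.Re (u t))}.
Proof.
apply: lip_continuous => z w; have := ger_Re_cabs (z - w).
by case: z => ? ?; case: w.
Qed.

Lemma continuous_Im (R : realType) (u : R -> R[i]) x :
  ccontinuous_at u x -> {for x, continuous (fun t => complex.Im (u t))}.
Proof.
apply: lip_continuous => z w; have := ger_Im_cabs (z - w).
by case: z => ? ?; case: w.
Qed.

Lemma continuous_cabs (R : realType) (u : R -> R[i]) x :
  ccontinuous_at u x -> {for x, continuous (fun t => cabs (u t))}.
Proof. by apply: lip_continuous => z w; exact: ler_dist_cabs. Qed.

Lemma ccontinuous_cst (R : realType) (c : R[i]) (x : R) :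
  ccontinuous_at (fun=> c) x.
Proof. by move=> e e0; exists 1 => // y _; rewrite subrr cabs0 ltW. Qed.

Lemma ccontinuousD (R : realType) (u v : R -> R[i]) x :
  ccontinuous_at u x -> ccontinuous_at v x ->
  ccontinuous_at (fun t => u t + v t) x.
Proof.
move=> ux vx e e0; have e2 : 0 < e / 2 by lra.
have [d d0 H] := ux _ e2; have [d' d'0 H'] := vx _ e2.
exists (Num.min d d') => [|y]; first by rewrite lt_min d0.
rewrite lt_min => /andP[/H h /H' h']; rewrite opprD addrACA.
by rewrite (le_trans (cabsD _ _))//; lra.
Qed.

Lemma ccontinuousM (R : realType) (u v : R -> R[i]) x :
  ccontinuous_at u x -> ccontinuous_at v x ->
  ccontinuous_at (fun t => u t * v t) x.
Proof.
move=> ux vx e e0.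
pose M := cabs (u x) + cabs (v x) + 1.
have M1 : 1 <= M by rewrite /M lerDr addr_ge0// cabs_ge0.
have e2 : 0 < Num.min 1 (e / (2 * M)) by rewrite lt_min ltr01 divr_gt0//; lra.
have [d d0 H] := ux _ e2; have [d' d'0 H'] := vx _ e2.
exists (Num.min d d') => [|y]; first by rewrite lt_min d0.
rewrite lt_min => /andP[/H + /H'].
rewrite !le_min !ler_pdivlMr; [|lra|lra] => /andP[h1 h2] /andP[h1' h2'].
rewrite (_ : _ - _ = (u y - u x) * v y + u x * (v y - v x)); last by ring.
have vy : cabs (v y) <= M.
  rewrite -(subrK (v x) (v y)) (le_trans (cabsD _ _))//.
  by rewrite /M; have := cabs_ge0 (u x); lra.
have uM : cabs (u x) <= M by rewrite /M; have := cabs_ge0 (v x); lra.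
rewrite (le_trans (cabsD _ _))// !cabsM.
have h3 : cabs (u y - u x) * cabs (v y) <= cabs (u y - u x) * M.
  by rewrite ler_wpM2l ?cabs_ge0.
have h4 : cabs (u x) * cabs (v y - v x) <= M * cabs (v y - v x).
  by rewrite ler_wpM2r ?cabs_ge0.
lra.
Qed.

Lemma ccontinuousB (R : realType) (u v : R -> R[i]) x :
  ccontinuous_at u x -> ccontinuous_at v x ->
  ccontinuous_at (fun t => u t - v t) x.
Proof.
move=> ux vx; apply: ccontinuousD => // e /vx[d d0 H].
by exists d => // y /H; rewrite -opprD cabsN.
Qed.

(** * Integrals over segments *)

Definition segment_integral (R : realType) (a b : R) (f : R -> R) : R :=
  \int[@lebesgue_measure R]_(t in `[a, b]%classic) f t.

Definition continuous_on (R : realType) (a b : R) (f : R -> R) :=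
  forall x, a <= x <= b -> {for x, continuous f}.

Definition ccontinuous_on (R : realType) (a b : R) (u : R -> R[i]) :=
  forall x, a <= x <= b -> ccontinuous_at u x.

Lemma continuous_on_integrable (R : realType) (a b : R) (f : R -> R) :
  continuous_on a b f ->
  (@lebesgue_measure R).-integrable `[a, b]%classic (EFin \o f).
Proof.
move=> cf; apply: continuous_compact_integrable; first exact: segment_compact.
apply: continuous_in_subspaceT => x; rewrite inE/= in_itv/= => xab.
exact: cf.
Qed.

Lemma segment_integralD (R : realType) (a b : R) (f g : R -> R) :
  continuous_on a b f -> continuous_on a b g ->
  segment_integral a b (fun t => f t + g t) =
  segment_integral a b f + segment_integral a b g.
Proof.
by move=> cf cg; apply: RintegralD => //; exact: continuous_on_integrable.
Qed.

Lemma segment_integralZl (R : realType) (a b r : R) (f : R -> R) :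
  continuous_on a b f ->
  segment_integral a b (fun t => r * f t) = r * segment_integral a b f.
Proof.
by move=> cf; apply: RintegralZl => //; exact: continuous_on_integrable.
Qed.

Lemma segment_integral_cst (R : realType) (a b r : R) : a <= b ->
  segment_integral a b (fun=> r) = r * (b - a).
Proof.
move=> ab; rewrite /segment_integral Rintegral_cst//= lebesgue_measure_itv/=.
rewrite lte_fin; case: ltP => //= ba.
by rewrite (_ : b = a) ?subrr//; apply/eqP; rewrite eq_le ab ba.
Qed.

Lemma le_segment_integral (R : realType) (a b : R) (f g : R -> R) :
  continuous_on a b f -> continuous_on a b g ->
  (forall x, a <= x <= b -> f x <= g x) ->
  segment_integral a b f <= segment_integral a b g.
Proof.
by move=> cf cg fg; apply: le_Rintegral => //; exact: continuous_on_integrable.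
Qed.

Lemma segment_integral_split (R : realType) (a m b : R) (f : R -> R) :
  a <= m <= b -> continuous_on a b f ->
  segment_integral a b f = segment_integral a m f + segment_integral m b f.
Proof.
move=> /andP[am mb] cf; have intf := continuous_on_integrable cf.
rewrite /segment_integral.
have := @Rintegral_itvB R f (BLeft a) (BRight b) m intf.
rewrite !bnd_simp => /(_ am mb) H.
rewrite -[X in _ = _ + X]Rintegral_itv_obnd_cbnd; last first.
  by apply: integrableS intf => //; apply: subset_itvr; rewrite bnd_simp.
by rewrite -H addrC subrK.
Qed.

Definition cintegral (R : realType) (a b : R) (u : R -> R[i]) : R[i] :=
  Complex (segment_integral a b (fun t => complex.Re (u t)))
          (segment_integral a b (fun t => complex.Im (u t))).

Lemma eq_cintegral (R : realType) (a b : R) (u v : R -> R[i]) :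
  (forall t, a <= t <= b -> u t = v t) -> cintegral a b u = cintegral a b v.
Proof.
by move=> uv; congr Complex; apply: eq_Rintegral => t;
  rewrite inE/= in_itv/= => /uv ->.
Qed.

Lemma cintegralD (R : realType) (a b : R) (u v : R -> R[i]) :
  ccontinuous_on a b u -> ccontinuous_on a b v ->
  cintegral a b (fun t => u t + v t) = cintegral a b u + cintegral a b v.
Proof.
move=> cu cv; rewrite /cintegral; apply/eqP; rewrite eq_complex/=.
rewrite -!segment_integralD; try by
  move=> x xab; (exact/continuous_Re/cu || exact/continuous_Re/cv ||
                 exact/continuous_Im/cu || exact/continuous_Im/cv).
by apply/andP; split; apply/eqP; congr segment_integral; apply/funext => t;
  case: (u t); case: (v t).
Qed.

Lemma cintegralZl (R : realType) (a b : R) (c : R[i]) (u : R -> R[i]) :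
  ccontinuous_on a b u ->
  cintegral a b (fun t => c * u t) = c * cintegral a b u.
Proof.
move=> cu.
have cRe : continuous_on a b (fun t => complex.Re (u t)).
  by move=> x /cu /continuous_Re.
have cIm : continuous_on a b (fun t => complex.Im (u t)).
  by move=> x /cu /continuous_Im.
have cZ r f : continuous_on a b f -> continuous_on a b (fun t => r * f t).
  by move=> cf x xab; apply: cvgMr; exact: cf.
case: c => p q; rewrite /cintegral; apply/eqP; rewrite eq_complex/=.
rewrite -mulNr -!segment_integralZl// -!segment_integralD; try exact: cZ.
by apply/andP; split; apply/eqP; congr segment_integral; apply/funext => t;
  case: (u t) => /= *; rewrite ?mulNr.
Qed.

Lemma cintegral_cst (R : realType) (a b : R) (c : R[i]) : a <= b ->
  cintegral a b (fun=> c) = c * ((b - a)%:C)%C.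
Proof.
move=> ab; rewrite /cintegral !segment_integral_cst//.
by case: c => p q; apply/eqP; rewrite eq_complex/= !mulr0 subr0 add0r !eqxx.
Qed.

Lemma cintegralB (R : realType) (a b : R) (u v : R -> R[i]) :
  ccontinuous_on a b u -> ccontinuous_on a b v ->
  cintegral a b (fun t => u t - v t) = cintegral a b u - cintegral a b v.
Proof.
move=> cu cv; rewrite -mulN1r -cintegralZl// -cintegralD//.
  by apply: eq_cintegral => t _; rewrite mulN1r.
by move=> x xab; apply: ccontinuousM (cv _ xab); exact: ccontinuous_cst.
Qed.

Lemma cintegral_split (R : realType) (a m b : R) (u : R -> R[i]) :
  a <= m <= b -> ccontinuous_on a b u ->
  cintegral a b u = cintegral a m u + cintegral m b u.
Proof.
move=> amb cu; apply/eqP; rewrite eq_complex/=.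
by rewrite -!segment_integral_split ?eqxx// => x /cu;
  [exact: continuous_Im|exact: continuous_Re].
Qed.

(** The factor 2 comes from estimating the real and imaginary parts
    separately. *)
Lemma le_cabs_cintegral (R : realType) (a b : R) (u : R -> R[i]) :
  ccontinuous_on a b u ->
  cabs (cintegral a b u) <= 2 * segment_integral a b (fun t => cabs (u t)).
Proof.
move=> cu; rewrite (le_trans (cabs_le_ReIm _))//= mulr_natl mulr2n.
have cRe : continuous_on a b (fun t => complex.Re (u t)).
  by move=> x /cu /continuous_Re.
have cIm : continuous_on a b (fun t => complex.Im (u t)).
  by move=> x /cu /continuous_Im.
have cn f : continuous_on a b f -> continuous_on a b (fun t => `|f t|).
  by move=> cf x /cf; exact: cvg_norm.
have cC : continuous_on a b (fun t => cabs (u t)).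
  by move=> x /cu /continuous_cabs.
by rewrite lerD// (le_trans (le_normr_Rintegral _ _))//;
  try exact: continuous_on_integrable;
  apply: le_segment_integral => //; try exact: cn;
  move=> x _; [exact: ger_Re_cabs|exact: ger_Im_cabs].
Qed.

(** All local error terms in Goursat's lemma are instances of this bound. *)
Lemma cintegral_approx (R : realType) (a b M : R) (c : R[i]) (u : R -> R[i]) :
  a <= b -> ccontinuous_on a b u ->
  (forall t, a <= t <= b -> cabs (u t - c) <= M) ->
  cabs (cintegral a b u - c * ((b - a)%:C)%C) <= 2 * M * (b - a).
Proof.
move=> ab cu uM; rewrite -cintegral_cst// -cintegralB//; last first.
  by move=> *; exact: ccontinuous_cst.
have cuc : ccontinuous_on a b (fun t => u t - c).
  by move=> x /cu cx; apply: ccontinuousB cx _; exact: ccontinuous_cst.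
rewrite (le_trans (le_cabs_cintegral cuc))// -mulrA ler_wpM2l//.
rewrite -segment_integral_cst//; apply: le_segment_integral => //.
  by move=> x /cuc /continuous_cabs.
by move=> x _; exact: cvg_cst.
Qed.

(** * Bisection of rectangles *)

Lemma nested_halves (R : realType) (x : nat -> R) (h : R) : 0 <= h ->
  (forall n, x n <= x n.+1 /\ x n.+1 + h / 2 ^+ n.+1 <= x n + h / 2 ^+ n) ->
  exists x0, forall n, x n <= x0 <= x n + h / 2 ^+ n.
Proof.
move=> h0 H.
have xnd m n : (m <= n)%N -> x m <= x n.
  elim: n => [|n IH]; first by rewrite leqn0 => /eqP ->.
  rewrite leq_eqVlt => /predU1P[->//|]; rewrite ltnS => /IH.
  by move/le_trans; apply; have [] := H n.
have xni m n : (m <= n)%N -> x n + h / 2 ^+ n <= x m + h / 2 ^+ m.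
  elim: n => [|n IH]; first by rewrite leqn0 => /eqP ->.
  rewrite leq_eqVlt => /predU1P[->//|]; rewrite ltnS => /IH.
  by apply: le_trans; have [] := H n.
have hn n : 0 <= h / 2 ^+ n by rewrite divr_ge0// exprn_ge0.
have ub n : ubound (range x) (x n + h / 2 ^+ n).
  move=> _ [m _ <-]; have [mn|nm] := leqP m n.
    by rewrite (le_trans (xnd _ _ mn))// lerDl.
  by rewrite (le_trans _ (xni _ _ (ltnW nm)))// lerDl.
exists (sup (range x)) => n; apply/andP; split.
  apply: ub_le_sup; first by exists (x 0 + h / 2 ^+ 0); exact: ub.
  by exists n.
by apply: ge_sup (ub n); exists (x 0); exists 0.
Qed.

(** Bisection as an induction principle: otherwise some nested sequence of bad
    quarters would shrink to a point. Both sides are halved in the same step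
    because the property it serves for, a bound by e (h' + g')^2, is inherited
    from the quarters but not from two halves. *)
Lemma rectangle_bisection (R : realType) (P : R -> R -> R -> R -> Prop)
    (a c h g : R) : 0 <= h -> 0 <= g ->
  (forall x y h' g', 0 <= h' -> 0 <= g' ->
     a <= x -> x + 2 * h' <= a + h -> c <= y -> y + 2 * g' <= c + g ->
     P x y h' g' -> P (x + h') y h' g' ->
     P x (y + g') h' g' -> P (x + h') (y + g') h' g' ->
     P x y (2 * h') (2 * g')) ->
  (forall x0 y0, a <= x0 <= a + h -> c <= y0 <= c + g ->
     exists2 d, 0 < d & forall x y h' g', 0 <= h' < d -> 0 <= g' < d ->
       a <= x -> x <= x0 <= x + h' -> x + h' <= a + h ->
       c <= y -> y <= y0 <= y + g' -> y + g' <= c + g -> P x y h' g') ->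
  P a c h g.
Proof.
move=> h0 g0 Psplit Ploc; apply: contrapT => nP.
pose H n := h / 2 ^+ n; pose G n := g / 2 ^+ n.
have HS n : H n = 2 * H n.+1.
  by rewrite /H exprS invfM mulrCA mulVKf// pnatr_eq0.
have GS n : G n = 2 * G n.+1.
  by rewrite /G exprS invfM mulrCA mulVKf// pnatr_eq0.
have Hn n : 0 <= H n by rewrite divr_ge0// exprn_ge0.
have Gn n : 0 <= G n by rewrite divr_ge0// exprn_ge0.
pose bad n (q : R * R) := [/\ a <= q.1, q.1 + H n <= a + h, c <= q.2,
  q.2 + G n <= c + g & ~ P q.1 q.2 (H n) (G n)].
have step (nq : nat * (R * R)) : exists q' : R * R, bad nq.1 nq.2 ->
    [/\ bad nq.1.+1 q', nq.2.1 <= q'.1,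
        q'.1 + H nq.1.+1 <= nq.2.1 + H nq.1, nq.2.2 <= q'.2 &
        q'.2 + G nq.1.+1 <= nq.2.2 + G nq.1].
  case: nq => n [x y] /=; have hn1 := Hn n.+1; have gn1 := Gn n.+1.
  have [[/= ax xh cy yg nQ]|nb] := pselect (bad n (x, y)); last first.
    by exists (x, y) => /nb.
  rewrite /bad HS GS in nQ xh yg *.
  have [q1|q1] := pselect (P x y (H n.+1) (G n.+1)); last first.
    by exists (x, y) => _ /=; split => //; [split => //|..]; lra.
  have [q2|q2] := pselect (P (x + H n.+1) y (H n.+1) (G n.+1)); last first.
    by exists (x + H n.+1, y) => _ /=; split => //; [split => //|..]; lra.
  have [q3|q3] := pselect (P x (y + G n.+1) (H n.+1) (G n.+1)); last first.
    by exists (x, y + G n.+1) => _ /=; split => //; [split => //|..]; lra.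
  have [q4|q4] := pselect (P (x + H n.+1) (y + G n.+1) (H n.+1) (G n.+1)); last first.
    by exists (x + H n.+1, y + G n.+1) => _ /=; split => //; [split => //|..]; lra.
  by case: nQ; apply: Psplit.
(* a bad quarter is chosen at each level; the corners converge *)
have [nxt nxtP] := boolp.choice step.
pose s := fix s n := if n is m.+1 then nxt (m, s m) else (a, c).
have sbad n : bad n (s n).
  elim: n => [|n IH]; first by rewrite /bad /H /G !expr0 !divr1/=; split.
  by have [] := nxtP (n, s n) IH.
have [x0 xP] : exists x0, forall n, (s n).1 <= x0 <= (s n).1 + H n.
  by apply: nested_halves => // n; have [] := nxtP (n, s n) (sbad n).
have [y0 yP] : exists y0, forall n, (s n).2 <= y0 <= (s n).2 + G n.
  by apply: nested_halves => // n; have [] := nxtP (n, s n) (sbad n).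
have [d d0 Hd] : exists2 d, 0 < d & forall x y h' g', 0 <= h' < d -> 0 <= g' < d ->
       a <= x -> x <= x0 <= x + h' -> x + h' <= a + h ->
       c <= y -> y <= y0 <= y + g' -> y + g' <= c + g -> P x y h' g'.
  apply: Ploc; [have := xP 0|have := yP 0]; rewrite /H /G expr0 divr1 //.
have [n hn] : exists n, (h + g) / 2 ^+ n < d.
  have [n nP'] : exists n : nat, (h + g) / d < n%:R.
    by exists (Num.truncn ((h + g) / d)).+1; rewrite truncnS_gt.
  exists n; rewrite ltr_pdivrMr ?exprn_gt0// mulrC -ltr_pdivrMr//.
  by rewrite (lt_le_trans nP')// -natrX ler_nat ltnW// ltn_expl.
have [b1 b2 b3 b4 b5] := sbad n.
apply: b5; apply: Hd => //; apply/andP; split => //; apply: le_lt_trans hn;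
  by rewrite ler_wpM2r ?invr_ge0 ?exprn_ge0// ?lerDl ?lerDr.
Qed.

(** * Goursat's lemma *)

(** F has a total differential at (x, y) that is proportional to the form
    l dx + k dy. This is what makes F (l dx + k dy) closed: formally,
    dF wedge (l dx + k dy) = D (l dx + k dy) wedge (l dx + k dy) = 0. *)
Definition form_differentiable (R : realType) (F : R -> R -> R[i])
    (l k : R -> R[i]) (x y : R) :=
  exists D : R[i], forall e : R, 0 < e -> exists2 d : R, 0 < d &
    forall x' y', `|x' - x| < d -> `|y' - y| < d ->
    cabs (F x' y' - F x y
          - D * (l x * ((x' - x)%:C)%C + k y * ((y' - y)%:C)%C))
      <= e * (`|x' - x| + `|y' - y|).

Lemma form_differentiable_continuous2 (R : realType) (F : R -> R -> R[i])
    (l k : R -> R[i]) (x y : R) :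
  form_differentiable F l k x y -> ccontinuous_at (F x) y.
Proof.
move=> [D HD] e e0; have [d d0 H] := HD _ ltr01.
pose M := cabs D * cabs (k y) + 1.
have M0 : 0 < M by rewrite ltr_wpDl// mulr_ge0// cabs_ge0.
exists (Num.min d (e / M)) => [|y']; first by rewrite lt_min d0 divr_gt0.
rewrite lt_min ltr_pdivlMr// => /andP[yd ye].
have := H x y'; rewrite subrr normr0 => /(_ d0 yd).
rewrite rmorph0 mulr0 !add0r mul1r => h0.
rewrite -(subrK (D * (k y * ((y' - y)%:C)%C)) (F x y' - _)).
rewrite (le_trans (cabsD _ _))// (le_trans _ (ltW ye))//.
apply: le_trans (lerD h0 (lexx _)) _.
by rewrite !cabsM cabs_real /M; lra.
Qed.

Lemma form_differentiable_swap (R : realType) (F : R -> R -> R[i])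
    (l k : R -> R[i]) (x y : R) :
  form_differentiable F l k x y ->
  form_differentiable (fun s t => F t s) k l y x.
Proof.
move=> [D HD]; exists D => e /HD[d d0 H]; exists d => // y' x' h1 h2.
by rewrite [_ + l x * _]addrC [_ + `|x' - x|]addrC; exact: H.
Qed.

(** The integral of the form F (l dx + k dy) along the boundary of the rectangle
    with lower left corner (a, c) and sides h, g. *)
Definition boundary_integral (R : realType) (F : R -> R -> R[i])
    (l k : R -> R[i]) (a c h g : R) : R[i] :=
  cintegral c (c + g) (fun y => (F (a + h) y - F a y) * k y) -
  cintegral a (a + h) (fun x => (F x (c + g) - F x c) * l x).

Section goursat.
Variables (R : realType) (F : R -> R -> R[i]) (l k : R -> R[i]) (a c h g : R).
Hypotheses (h0 : 0 <= h) (g0 : 0 <= g).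
Hypothesis lc : ccontinuous_on a (a + h) l.
Hypothesis kc : ccontinuous_on c (c + g) k.
Hypothesis Fd : forall x y, a <= x <= a + h -> c <= y <= c + g ->
  form_differentiable F l k x y.

Let vert_cont x1 x2 y : a <= x1 <= a + h -> a <= x2 <= a + h ->
  c <= y <= c + g -> ccontinuous_at (fun t => (F x2 t - F x1 t) * k t) y.
Proof.
move=> x1P x2P yP; apply: ccontinuousM (kc yP).
by apply: ccontinuousB; apply: form_differentiable_continuous2; exact: Fd.
Qed.

Let horiz_cont y1 y2 x : c <= y1 <= c + g -> c <= y2 <= c + g ->
  a <= x <= a + h -> ccontinuous_at (fun t => (F t y2 - F t y1) * l t) x.
Proof.
move=> y1P y2P xP; apply: ccontinuousM (lc xP).
by apply: ccontinuousB;
  apply: (@form_differentiable_continuous2 R (fun s t => F t s) k l);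
  exact/form_differentiable_swap/Fd.
Qed.

Lemma boundary_integral_split x y h' g' : 0 <= h' -> 0 <= g' ->
  a <= x -> x + 2 * h' <= a + h -> c <= y -> y + 2 * g' <= c + g ->
  boundary_integral F l k x y (2 * h') (2 * g') =
  boundary_integral F l k x y h' g' + boundary_integral F l k (x + h') y h' g' +
  boundary_integral F l k x (y + g') h' g' +
  boundary_integral F l k (x + h') (y + g') h' g'.
Proof.
move=> h'0 g'0 ax xh cy yg; rewrite /boundary_integral.
rewrite (@cintegral_split _ y (y + g') (y + 2 * g')); [|lra|]; last first.
  by move=> t tP; apply: vert_cont; lra.
rewrite (@cintegral_split _ x (x + h') (x + 2 * h')); [|lra|]; last first.
  by move=> t tP; apply: horiz_cont; lra.
have yE : y + g' + g' = y + 2 * g' by ring.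
have xE : x + h' + h' = x + 2 * h' by ring.
rewrite yE xE.
have V y1 y2 : c <= y1 -> y2 <= c + g ->
    cintegral y1 y2 (fun t => (F (x + 2 * h') t - F x t) * k t) =
    cintegral y1 y2 (fun t => (F (x + h') t - F x t) * k t) +
    cintegral y1 y2 (fun t => (F (x + 2 * h') t - F (x + h') t) * k t).
  move=> y1P y2P; rewrite -cintegralD; [|by move=> t tP; apply: vert_cont; lra..].
  by apply: eq_cintegral => t _; ring.
have W x1 x2 : a <= x1 -> x2 <= a + h ->
    cintegral x1 x2 (fun t => (F t (y + 2 * g') - F t y) * l t) =
    cintegral x1 x2 (fun t => (F t (y + g') - F t y) * l t) +
    cintegral x1 x2 (fun t => (F t (y + 2 * g') - F t (y + g')) * l t).
  move=> x1P x2P; rewrite -cintegralD; [|by move=> t tP; apply: horiz_cont; lra..].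
  by apply: eq_cintegral => t _; ring.
rewrite (V y (y + g')); [|lra|lra]; rewrite (V (y + g')); [|lra|lra].
rewrite (W x (x + h')); [|lra|lra]; rewrite (W (x + h')); [|lra|lra].
by ring.
Qed.

(** Near (x0, y0), both the vertical and the horizontal integrals are equal to
    D l k h' g', taken at (x0, y0), up to o((h' + g')^2); in the difference
    these main terms cancel. *)
Lemma boundary_integral_local x0 y0 e :
  a <= x0 <= a + h -> c <= y0 <= c + g -> 0 < e ->
  exists2 d, 0 < d & forall x y h' g', 0 <= h' < d -> 0 <= g' < d ->
       a <= x -> x <= x0 <= x + h' -> x + h' <= a + h ->
       c <= y -> y <= y0 <= y + g' -> y + g' <= c + g ->
  cabs (boundary_integral F l k x y h' g') <= e * (h' + g') ^+ 2.
Proof.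
move=> x0P y0P e0; have [D HD] := Fd x0P y0P.
pose K := cabs (k y0); pose L := cabs (l x0); pose Q := cabs D.
have [K0 L0 Q0] : [/\ 0 <= K, 0 <= L & 0 <= Q] by rewrite !cabs_ge0.
pose M := 2 * (K + L + 1) + Q * (K + L).
have M0 : 0 < M.
  by rewrite /M; have : 0 <= Q * (K + L); [rewrite mulr_ge0// addr_ge0|lra].
pose n := Num.min 1 (e / (2 * M)).
have n0 : 0 < n by rewrite lt_min ltr01 divr_gt0//; lra.
have [n1 nM] : n <= 1 /\ 2 * n * M <= e.
  split; first by rewrite ge_min lexx.
  rewrite mulrAC -ler_pdivlMl; last lra.
  by rewrite mulrC ge_min lexx orbT.
have [d1 d10 H1] := HD _ n0.
have [d2 d20 H2] := lc x0P n0.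
have [d3 d30 H3] := kc y0P n0.
exists (Num.min d1 (Num.min d2 d3)) => [|x y h' g']; first by rewrite !lt_min d10 d20.
rewrite !lt_min => /andP[h'0 /and3P[hd1 hd2 hd3]] /andP[g'0 /and3P[gd1 gd2 gd3]].
move=> ax x0h xh cy y0g yg.
have dx x' : x <= x' <= x + h' -> `|x' - x0| <= h'.
  by move=> ?; rewrite ler_norml; apply/andP; split; lra.
have dy y' : y <= y' <= y + g' -> `|y' - y0| <= g'.
  by move=> ?; rewrite ler_norml; apply/andP; split; lra.
pose r s t := F s t - F x0 y0
          - D * (l x0 * ((s - x0)%:C)%C + k y0 * ((t - y0)%:C)%C).
have rP s t : x <= s <= x + h' -> y <= t <= y + g' ->
    cabs (r s t) <= n * (h' + g').
  move=> sP tP; have h1 := dx _ sP; have h2 := dy _ tP.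
  apply: le_trans (H1 _ _ (le_lt_trans h1 hd1) (le_lt_trans h2 gd1)) _.
  by rewrite ler_wpM2l ?(ltW n0)// lerD.
have kP t : y <= t <= y + g' -> cabs (k t - k y0) <= n.
  by move=> /dy h1; apply: H3; exact: le_lt_trans h1 _.
have lP t : x <= t <= x + h' -> cabs (l t - l x0) <= n.
  by move=> /dx h1; apply: H2; exact: le_lt_trans h1 _.
have kb t : y <= t <= y + g' -> cabs (k t) <= K + 1.
  move=> /kP h1; rewrite -(subrK (k y0) (k t)) (le_trans (cabsD _ _))//.
  by rewrite addrC lerD// (le_trans h1).
have lb t : x <= t <= x + h' -> cabs (l t) <= L + 1.
  move=> /lP h1; rewrite -(subrK (l x0) (l t)) (le_trans (cabsD _ _))//.
  by rewrite addrC lerD// (le_trans h1).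
(* A h' g' is the common main term of the vertical and horizontal integrals *)
pose A := D * l x0 * k y0.
have hg0 : 0 <= n * (h' + g') by apply: mulr_ge0; [exact: ltW|exact: addr_ge0].
have hg : h' <= h' + g' by rewrite lerDl.
have gh : g' <= h' + g' by rewrite lerDr.
have V : cabs (cintegral y (y + g') (fun t => (F (x + h') t - F x t) * k t)
    - A * (h'%:C)%C * ((y + g' - y)%:C)%C) <= 2 * (n * (h' + g') * M) * (y + g' - y).
  apply: cintegral_approx; [lra|by move=> t tP; apply: vert_cont; lra|].
  move=> t tP; rewrite (_ : _ - _ = (r (x + h') t - r x t) * k t
     + D * l x0 * (h'%:C)%C * (k t - k y0)); last first.
    rewrite /r /A !rmorphB !rmorphD/=; ring.
  rewrite (le_trans (cabsD _ _))// !cabsM cabs_real ger0_norm//.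
  have b1 : cabs (r (x + h') t - r x t) * cabs (k t) <= 2 * (n * (h' + g')) * (K + 1).
    rewrite ler_pM ?cabs_ge0 ?kb// (le_trans (cabsB _ _))// mulr_natl mulr2n.
    by rewrite lerD// rP//; lra.
  have b2 : cabs D * cabs (l x0) * h' * cabs (k t - k y0) <= Q * L * (h' + g') * n.
    by rewrite ler_pM ?cabs_ge0 ?kP ?mulr_ge0 ?cabs_ge0// ler_wpM2l// mulr_ge0.
  apply: le_trans (lerD b1 b2) _.
  rewrite (_ : _ + _ = n * (h' + g') * (2 * (K + 1) + Q * L)); last by ring.
  rewrite ler_wpM2l// /M; have := mulr_ge0 Q0 K0; lra.
have W : cabs (cintegral x (x + h') (fun t => (F t (y + g') - F t y) * l t)
    - A * (g'%:C)%C * ((x + h' - x)%:C)%C) <= 2 * (n * (h' + g') * M) * (x + h' - x).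
  apply: cintegral_approx; [lra|by move=> t tP; apply: horiz_cont; lra|].
  move=> t tP; rewrite (_ : _ - _ = (r t (y + g') - r t y) * l t
     + D * k y0 * (g'%:C)%C * (l t - l x0)); last first.
    rewrite /r /A !rmorphB !rmorphD/=; ring.
  rewrite (le_trans (cabsD _ _))// !cabsM cabs_real ger0_norm//.
  have b1 : cabs (r t (y + g') - r t y) * cabs (l t) <= 2 * (n * (h' + g')) * (L + 1).
    rewrite ler_pM ?cabs_ge0 ?lb// (le_trans (cabsB _ _))// mulr_natl mulr2n.
    by rewrite lerD// rP//; lra.
  have b2 : cabs D * cabs (k y0) * g' * cabs (l t - l x0) <= Q * K * (h' + g') * n.
    by rewrite ler_pM ?cabs_ge0 ?lP ?mulr_ge0 ?cabs_ge0// ler_wpM2l// mulr_ge0.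
  apply: le_trans (lerD b1 b2) _.
  rewrite (_ : _ + _ = n * (h' + g') * (2 * (L + 1) + Q * K)); last by ring.
  rewrite ler_wpM2l// /M; have := mulr_ge0 Q0 L0; lra.
rewrite !(addrAC _ _ (- _)) !subrr !add0r in V W.
rewrite /boundary_integral.
set I1 := cintegral y _ _ in V *; set I2 := cintegral x _ _ in W *.
rewrite (_ : I1 - I2 = (I1 - A * (h'%:C)%C * (g'%:C)%C) -
   (I2 - A * (g'%:C)%C * (h'%:C)%C)); last by ring.
rewrite (le_trans (cabsB _ _))// (le_trans (lerD V W))//.
rewrite (_ : _ + _ = 2 * n * M * (h' + g') ^+ 2); last by ring.
by rewrite ler_wpM2r ?sqr_ge0.
Qed.

(** Goursat's lemma. The derivatives exist only pointwise and cannot be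
    integrated over the rectangle; instead, bisection bounds the boundary
    integral by e (h + g)^2 for every e > 0. *)
Theorem boundary_integral_eq0 : boundary_integral F l k a c h g = 0.
Proof.
apply: cabs_eq0; apply/eqP; rewrite eq_le cabs_ge0 andbT.
apply/ler_addgt0Pr => e e0; rewrite add0r.
pose e' := e / ((h + g) ^+ 2 + 1).
have s0 : 0 <= (h + g) ^+ 2 by rewrite sqr_ge0.
have e'0 : 0 < e' by rewrite divr_gt0//; lra.
apply: (@le_trans _ _ (e' * (h + g) ^+ 2)); last first.
  rewrite /e' mulrAC ler_pdivrMr; last lra.
  by rewrite ler_pM2l//; lra.
apply: (@rectangle_bisection R (fun x y h' g' =>
  cabs (boundary_integral F l k x y h' g') <= e' * (h' + g') ^+ 2)) => //.
- move=> x y h' g' ? ? ? ? ? ? p1 p2 p3 p4; rewrite boundary_integral_split//.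
  apply: (@le_trans _ _ (e' * (h' + g') ^+ 2 + e' * (h' + g') ^+ 2 +
    e' * (h' + g') ^+ 2 + e' * (h' + g') ^+ 2)); last by lra.
  by do 3 (rewrite (le_trans (cabsD _ _))// lerD//).
- by move=> x0 y0 x0P y0P; exact: boundary_integral_local.
Qed.

End goursat.

(** * Complex differentiability and circles *)

(** Stated over an arbitrary field of numbers because it serves both for the
    real functions cos and sin and for holomorphic functions. *)
Lemma derivable_expansion (K : numFieldType) (f : K -> K) (z : K) :
  derivable (f : K^o -> K^o) z 1 ->
  forall e : K, 0 < e -> exists2 d : K, 0 < d & forall w, `|w - z| < d ->
    `|f w - f z - 'D_1 (f : K^o -> K^o) z * (w - z)| <= e * `|w - z|.
Proof.
move=> /cvg_ex[/= l fl] e e0.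
have -> : 'D_1 (f : K^o -> K^o) z = l by apply: cvg_lim fl.
move/cvgrPdist_le : fl => /(_ e e0) [d /= d0 H]; exists d => // w wd.
have [->|wz] := eqVneq w z; first by rewrite !subrr mulr0 subr0 normr0 mulr0.
have wz' : w - z != 0 by rewrite subr_eq0.
have := H (w - z); rewrite /= distrC subr0 => /(_ wd wz').
rewrite -[_ *: 1]/(_ * 1) mulr1 subrK.
have wz0 : 0 < `|w - z| by rewrite normr_gt0.
rewrite -(ler_pM2r wz0) -normrM; congr (_ <= _); rewrite -normrN; congr `|_|.
by rewrite mulrBl opprB -[_ *: _]/(_ * _) mulrAC mulVf ?mul1r.
Qed.

Definition cdifferentiable_at (R : realType) (f : R[i] -> R[i]) (z : R[i]) :=
  exists D : R[i], forall e : R, 0 < e -> exists2 d : R, 0 < d &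
    forall w, cabs (w - z) < d ->
      cabs (f w - f z - D * (w - z)) <= e * cabs (w - z).

Lemma normcE_cabs (R : realType) (z : R[i]) : `|z| = ((cabs z)%:C)%C.
Proof. by []. Qed.

Lemma derivable_cdifferentiable (R : realType) (f : R[i] -> R[i]) (z : R[i]) :
  derivable (f : R[i]^o -> R[i]^o) z 1 -> cdifferentiable_at f z.
Proof.
move=> /derivable_expansion H; eexists => e e0.
have [|d d0 Hd] := H (e%:C)%C; first by rewrite ltcR.
have dR : d = ((complex.Re d)%:C)%C by rewrite RRe_real// gtr0_real.
exists (complex.Re d) => [|w wd]; first by rewrite -ltcR -dR.
by have := Hd w; rewrite !normcE_cabs -rmorphM/= lecR dR ltcR; apply.
Qed.

Lemma cdifferentiable_continuous (R : realType) (f : R[i] -> R[i]) (z : R[i]) :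
  cdifferentiable_at f z -> forall e : R, 0 < e -> exists2 d : R, 0 < d &
    forall w, cabs (w - z) < d -> cabs (f w - f z) <= e.
Proof.
move=> [D HD] e e0; have [d d0 H] := HD _ ltr01.
pose M := cabs D + 1; have M0 : 0 < M by rewrite ltr_wpDl// cabs_ge0.
exists (Num.min d (e / M)) => [|w]; first by rewrite lt_min d0 divr_gt0.
rewrite lt_min ltr_pdivlMr// => /andP[/H h we].
rewrite -(subrK (D * (w - z)) (f w - _)).
rewrite (le_trans (cabsD _ _))// (le_trans _ (ltW we))//.
apply: le_trans (lerD h (lexx _)) _.
by rewrite !cabsM /M; lra.
Qed.

Lemma ccontinuous_comp (R : realType) (f : R[i] -> R[i]) (u : R -> R[i]) (x : R) :
  cdifferentiable_at f (u x) -> ccontinuous_at u x ->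
  ccontinuous_at (fun t => f (u t)) x.
Proof.
move=> /cdifferentiable_continuous fu ux e /fu[d d0 H].
have d2 : 0 < d / 2 by lra.
have [d' d'0 H'] := ux _ d2; exists d' => // y /H' h.
by apply: H; lra.
Qed.

Lemma ccontinuousV (R : realType) (u : R -> R[i]) (x : R) :
  u x != 0 -> ccontinuous_at u x -> ccontinuous_at (fun t => (u t)^-1) x.
Proof.
move=> u0 ux e e0; have A0 := cabs_gt0 u0; set A := cabs (u x) in A0 *.
have m0 : 0 < Num.min (A / 2) (e * A ^+ 2 / 2).
  by rewrite lt_min !divr_gt0// mulr_gt0// exprn_gt0.
have [d d0 H] := ux _ m0; exists d => // y /H.
rewrite le_min => /andP[h1 h2].
have uyA : A / 2 <= cabs (u y).
  have := cabsB (u y) (u y - u x); rewrite opprB addrCA subrr addr0 -/A; lra.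
have uy0 : u y != 0.
  by apply/eqP => uy; move: uyA; rewrite uy cabs0; lra.
rewrite (_ : _ - _ = - (u y - u x) / (u x * u y)); last first.
  by field; rewrite ?u0 ?uy0.
rewrite cabsM cabsN cabsV cabsM -/A ler_pdivrMr; last by rewrite mulr_gt0//; lra.
apply: le_trans h2 _; rewrite expr2 -!mulrA ler_pM2l// ler_pM2l//.
Qed.

Lemma circle_pt_cabs (R : realType) (r t : R) : 0 <= r -> cabs (circle_pt r t) = r.
Proof.
move=> r0; rewrite /cabs /= !exprMn -mulrDr cos2Dsin2 mulr1 sqrtr_sqr.
by rewrite ger0_norm.
Qed.

Lemma circle_pt_expansion (R : realType) (r t : R) (e : R) : 0 < e ->
  exists2 d : R, 0 < d & forall t', `|t' - t| < d ->
    cabs (circle_pt r t' - circle_pt r t - 'i%C * circle_pt r t * ((t' - t)%:C)%C)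
      <= e * `|t' - t|.
Proof.
move=> e0; pose q := e / (2 * (`|r| + 1)).
have r1 : 0 < `|r| + 1 by rewrite ltr_wpDl.
have q0 : 0 < q by rewrite divr_gt0// mulr_gt0.
have [d1 d10 H1] := @derivable_expansion R cos t (@ex_derive _ _ _ _ _ _ _ (is_derive_cos t)) q q0.
have [d2 d20 H2] := @derivable_expansion R sin t (@ex_derive _ _ _ _ _ _ _ (is_derive_sin t)) q q0.
exists (Num.min d1 d2) => [|t']; first by rewrite lt_min d10.
rewrite lt_min => /andP[/H1 + /H2].
rewrite !derive_val => h1 h2.
apply: le_trans (cabs_le_ReIm _) _ => /=.
have -> : r * cos t' - r * cos t - ((0 * (r * cos t) - 1 * (r * sin t)) * (t' - t)
   - (0 * (r * sin t) + 1 * (r * cos t)) * 0)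
   = r * (cos t' - cos t - (- sin t) * (t' - t)) by ring.
have -> : r * sin t' - r * sin t - ((0 * (r * cos t) - 1 * (r * sin t)) * 0
   + (0 * (r * sin t) + 1 * (r * cos t)) * (t' - t))
   = r * (sin t' - sin t - cos t * (t' - t)) by ring.
rewrite !normrM -mulrDr.
apply: (@le_trans _ _ (`|r| * (2 * (q * `|t' - t|)))).
  by rewrite ler_wpM2l// mulr_natl mulr2n lerD.
rewrite (_ : _ * _ = (`|r| * (2 * q)) * `|t' - t|); last by ring.
rewrite ler_wpM2r// (_ : `|r| * _ = e * (`|r| / (`|r| + 1))); last first.
  by rewrite /q; field; rewrite gt_eqF.
by rewrite ger_pMr// ler_pdivrMr// mul1r; lra.
Qed.

Lemma circle_pt_ccontinuous (R : realType) (r t : R) :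
  ccontinuous_at (circle_pt r) t.
Proof.
move=> e e0; have [d d0 H] := @circle_pt_expansion R r t 1 ltr01.
pose M := cabs (circle_pt r t) + 1.
have M0 : 0 < M by rewrite ltr_wpDl// cabs_ge0.
exists (Num.min d (e / M)) => [|y']; first by rewrite lt_min d0 divr_gt0.
rewrite lt_min ltr_pdivlMr// => /andP[/H h ye].
rewrite -(subrK ('i%C * circle_pt r t * ((y' - t)%:C)%C) (circle_pt r y' - _)).
rewrite (le_trans (cabsD _ _))// (le_trans _ (ltW ye))//.
apply: le_trans (lerD h (lexx _)) _.
by rewrite !cabsM cabs_real cabs_i /M; lra.
Qed.

(** * Cauchy's formula *)

Lemma form_differentiable_comp (R : realType) (f : R[i] -> R[i])
    (W : R -> R -> R[i]) (l k : R -> R[i]) (x y : R) :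
  form_differentiable W l k x y -> cdifferentiable_at f (W x y) ->
  form_differentiable (fun s t => f (W s t)) l k x y.
Proof.
move=> [A HA] [B HB]; exists (B * A) => e e0.
pose a := cabs A; pose b := cabs B.
pose m := cabs (l x) + cabs (k y).
have [a0 b0 m0] : [/\ 0 <= a, 0 <= b & 0 <= m] by rewrite addr_ge0 ?cabs_ge0.
pose M := a * m + 1.
have M1 : 1 <= M by rewrite lerDr mulr_ge0.
have e1 : 0 < e / (2 * M) by rewrite divr_gt0//; lra.
have e2 : 0 < Num.min 1 (e / (2 * (b + 1))).
  by rewrite lt_min ltr01 divr_gt0//; lra.
have [d1 d10 H1] := HB _ e1; have [d2 d20 H2] := HA _ e2.
have dM : 0 < d1 / (2 * M) by rewrite divr_gt0//; lra.
exists (Num.min d2 (d1 / (2 * M))) => [|x' y']; first by rewrite lt_min d20.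
rewrite !lt_min => /andP[xd2 xd1] /andP[yd2 yd1].
set t := `|x' - x| + `|y' - y|.
have t0 : 0 <= t by rewrite addr_ge0.
set L := l x * _ + _.
have Lm : cabs L <= m * t.
  rewrite (le_trans (cabsD _ _))// !cabsM !cabs_real.
  have := mulr_ge0 (cabs_ge0 (l x)) (normr_ge0 (y' - y)).
  have := mulr_ge0 (cabs_ge0 (k y)) (normr_ge0 (x' - x)).
  by rewrite /m /t; lra.
have := H2 _ _ xd2 yd2; rewrite -/L -/t => h2.
have h21 : cabs (W x' y' - W x y - A * L) <= t.
  by rewrite (le_trans h2)// -[leRHS]mul1r ler_wpM2r// ge_min lexx.
have h22 : cabs (W x' y' - W x y - A * L) <= e / (2 * (b + 1)) * t.
  by rewrite (le_trans h2)// ler_wpM2r// ge_min lexx orbT.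
have hW : cabs (W x' y' - W x y) <= M * t.
  rewrite -(subrK (A * L) (_ - W x y)) (le_trans (cabsD _ _))//.
  have : cabs (A * L) <= a * (m * t) by rewrite cabsM ler_wpM2l.
  by rewrite /M; lra.
have /H1 h1 : cabs (W x' y' - W x y) < d1.
  apply: le_lt_trans hW _.
  have : t < 2 * (d1 / (2 * M)) by rewrite /t; lra.
  rewrite (_ : 2 * _ = d1 / M); last by field; lra.
  by rewrite [M * t]mulrC ltr_pdivlMr//; lra.
rewrite (_ : _ - _ = (f (W x' y') - f (W x y) - B * (W x' y' - W x y)) +
  B * (W x' y' - W x y - A * L)); last by ring.
rewrite (le_trans (cabsD _ _))//.
have h3 : e / (2 * M) * cabs (W x' y' - W x y) <= e / 2 * t.
  apply: (@le_trans _ _ (e / (2 * M) * (M * t))); first by rewrite ler_wpM2l// ltW.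
  by rewrite (_ : _ * _ = e / 2 * t)//; field; lra.
have h4 : cabs (B * (W x' y' - W x y - A * L)) <= e / 2 * t.
  rewrite cabsM -/b (le_trans (ler_wpM2l b0 h22))//.
  rewrite mulrA ler_wpM2r//.
  rewrite (_ : b * _ = e / 2 * (b / (b + 1))); last by field; lra.
  by rewrite ger_pMr ?ler_pdivrMr; lra.
by have := h1; lra.
Qed.

(** For s from 1 down to 0, the circle of radius r contracted to z along
    segments. *)
Definition star_path (R : realType) (r : R) (z : R[i]) (s t : R) : R[i] :=
  z + (s%:C)%C * (circle_pt r t - z).

(** The logarithmic derivative in t of the circle seen from z. Since
    star_path - z = s (circle_pt r t - z), it is also the coefficient of dt in
    d log (star_path - z) = ds / s + cauchy_kernel dt. *)
Definition cauchy_kernel (R : realType) (r : R) (z : R[i]) (t : R) : R[i] :=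
  'i%C * circle_pt r t / (circle_pt r t - z).

Lemma circle_pt_subr_neq0 (R : realType) (r t : R) (z : R[i]) :
  cabs z < r -> circle_pt r t - z != 0.
Proof.
move=> zr; have r0 : 0 <= r by have := cabs_ge0 z; lra.
by rewrite subr_eq0; apply/eqP => zE; rewrite -zE circle_pt_cabs// ltxx in zr.
Qed.

(** The differential of star_path is (star_path - z) d log (star_path - z).
    The weight of ds is s^-1 and the weight of dt is the Cauchy kernel. *)
Lemma star_path_form_differentiable (R : realType) (r : R) (z : R[i]) (s t : R) :
  cabs z < r -> 0 < s ->
  form_differentiable (star_path r z)
    (fun x => (x%:C)%C^-1) (cauchy_kernel r z) s t.
Proof.
move=> zr s0; exists (star_path r z s t - z) => e e0.
have ez := circle_pt_subr_neq0 t zr.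
have es : 0 < e / s by rewrite divr_gt0.
have [d1 d10 H1] := @circle_pt_expansion R r t _ es.
have [d2 d20 H2] := @circle_pt_ccontinuous R r t _ e0.
exists (Num.min d1 d2) => [|x' y' _]; first by rewrite lt_min d10.
rewrite lt_min => /andP[/H1 h1 /H2 h2].
have sC : (s%:C)%C != 0 by rewrite -[0]/(0%:C)%C (inj_eq (@complexI R)) gt_eqF.
rewrite (_ : _ - _ = (s%:C)%C * (circle_pt r y' - circle_pt r t -
    'i%C * circle_pt r t * ((y' - t)%:C)%C)
  + ((x' - s)%:C)%C * (circle_pt r y' - circle_pt r t)); last first.
  by rewrite /star_path /cauchy_kernel !rmorphB/=; field; rewrite ez sC.
rewrite (le_trans (cabsD _ _))// !cabsM !cabs_real [X in X * _]gtr0_norm//.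
rewrite mulrDr addrC lerD//.
  by rewrite mulrC ler_wpM2r.
by rewrite (le_trans (ler_wpM2l (ltW s0) h1))// mulrA [s * _]mulrC divfK// gt_eqF.
Qed.

Lemma star_path_cabs (R : realType) (r : R) (z : R[i]) (s t : R) :
  cabs z <= r -> 0 <= s <= 1 -> cabs (star_path r z s t) <= r.
Proof.
move=> zr /andP[s0 s1]; have r0 : 0 <= r := le_trans (cabs_ge0 z) zr.
rewrite (_ : star_path _ _ _ _ = ((1 - s)%:C)%C * z + (s%:C)%C * circle_pt r t).
  rewrite (le_trans (cabsD _ _))// !cabsM !cabs_real circle_pt_cabs//.
  rewrite !ger0_norm ?subr_ge0//.
  have : (1 - s) * cabs z <= (1 - s) * r by rewrite ler_wpM2l ?subr_ge0.
  lra.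
by rewrite /star_path !rmorphB/= rmorph1; ring.
Qed.

Lemma circle_pt_2pi (R : realType) (r : R) :
  circle_pt r (2 * pi) = circle_pt r 0.
Proof. by rewrite /circle_pt mulr_natl cos2pi sin2pi cos0 sin0. Qed.

Lemma cauchy_kernel_ccontinuous (R : realType) (r : R) (z : R[i]) (t : R) :
  cabs z < r -> ccontinuous_at (cauchy_kernel r z) t.
Proof.
move=> zr; have cc := @circle_pt_ccontinuous R r t.
apply: ccontinuousM; first by apply: ccontinuousM => //; exact: ccontinuous_cst.
apply: ccontinuousV; first exact: circle_pt_subr_neq0.
by apply: ccontinuousB => //; exact: ccontinuous_cst.
Qed.

Lemma cauchy_kernel_le (R : realType) (r : R) (z : R[i]) (t : R) :
  cabs z < r -> cabs (cauchy_kernel r z t) <= r / (r - cabs z).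
Proof.
move=> zr; have z0 := cabs_ge0 z.
rewrite !cabsM cabsV circle_pt_cabs; last lra.
rewrite cabs_i mul1r ler_wpM2l//; first lra.
have h : r - cabs z <= cabs (circle_pt r t - z).
  have := cabsD (circle_pt r t - z) z; rewrite subrK circle_pt_cabs; lra.
by rewrite lef_pV2 ?posrE//; lra.
Qed.

Section cauchy.
Variables (R : realType) (f : R[i] -> R[i]) (r : R) (z : R[i]).
Hypothesis zr : cabs z < r.
Hypothesis fd : forall w, cabs w <= r -> cdifferentiable_at f w.

Let k := cauchy_kernel r z.
Let F s t := f (star_path r z s t).

Let Fd s t : 0 < s <= 1 ->
  form_differentiable F (fun x => (x%:C)%C^-1) k s t.
Proof.
move=> /andP[s0 s1]; apply: form_differentiable_comp.
  exact: star_path_form_differentiable.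
by apply: fd; apply: star_path_cabs; rewrite ltW.
Qed.

Let Fc s t : 0 < s <= 1 -> ccontinuous_at (F s) t.
Proof. by move=> /Fd sP; exact: form_differentiable_continuous2 (sP t). Qed.

(** Goursat's lemma on [s, 1] x [0, 2 pi]. The two sides t = 0 and t = 2 pi
    cancel by periodicity; the two others are the integrals compared here. *)
Lemma star_integral_const s : 0 < s <= 1 ->
  cintegral 0 (2 * pi) (fun t => F s t * k t) =
  cintegral 0 (2 * pi) (fun t => F 1 t * k t).
Proof.
move=> /andP[s0 s1].
have sP x : s <= x <= s + (1 - s) -> 0 < x <= 1.
  by move=> ?; apply/andP; split; lra.
have s1E : s + (1 - s) = 1 by ring.
have pi0 : 0 <= 2 * pi :> R by rewrite mulr_ge0// pi_ge0.
have lc : ccontinuous_on s (s + (1 - s)) (fun x : R => (x%:C)%C^-1).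
  move=> x /sP /andP[x0 _]; apply: ccontinuousV.
    by rewrite -[0]/(0%:C)%C (inj_eq (@complexI R)) gt_eqF.
  by move=> e e0; exists e => // y ye; rewrite -rmorphB cabs_real ltW.
have kc : ccontinuous_on 0 (0 + 2 * pi) k.
  by move=> t _; exact: cauchy_kernel_ccontinuous.
have s1' : 0 <= 1 - s by lra.
have := boundary_integral_eq0 s1' pi0 lc kc (fun x y xP _ => Fd y (sP x xP)).
rewrite /boundary_integral add0r s1E.
have -> : cintegral s 1 (fun x => (F x (2 * pi) - F x 0) * (x%:C)%C^-1) = 0.
  rewrite (@eq_cintegral _ _ _ _ (fun=> 0)).
    by rewrite cintegral_cst// mul0r.
  by move=> t _; rewrite /F /star_path circle_pt_2pi subrr mul0r.
rewrite subr0 => I0; apply/esym/eqP; rewrite -subr_eq0 -cintegralB.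
- rewrite -I0; apply/eqP/eq_cintegral => t _; exact/esym/mulrBl.
- by move=> t _; apply: ccontinuousM (cauchy_kernel_ccontinuous _ zr);
    apply: Fc; rewrite ltr01 lexx.
- by move=> t _; apply: ccontinuousM (cauchy_kernel_ccontinuous _ zr);
    apply: Fc; rewrite s0.
Qed.

(** Let s tend to 0 in [star_integral_const]: the contracted circle shrinks to z,
    so the integral tends to f z times the integral of the kernel. The latter
    is left unevaluated, since a lower bound for its modulus suffices. *)
Lemma cauchy_formula :
  cintegral 0 (2 * pi) (fun t => f (circle_pt r t) * k t) =
  f z * cintegral 0 (2 * pi) k.
Proof.
have pi0 : 0 <= 2 * pi :> R by rewrite mulr_ge0// pi_ge0.
have zr' := zr; have z0 := cabs_ge0 z; have r0 : 0 < r by lra.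
have kc : ccontinuous_on 0 (2 * pi) k.
  by move=> t _; exact: cauchy_kernel_ccontinuous.
have F1 t : F 1 t = f (circle_pt r t).
  by rewrite /F /star_path rmorph1 mul1r addrC subrK.
under eq_fun do rewrite -F1.
apply/eqP; rewrite -subr_eq0; apply/eqP/cabs_eq0/eqP.
rewrite eq_le cabs_ge0 andbT; apply/ler_addgt0Pr => e e0; rewrite add0r.
pose K := r / (r - cabs z); have K0 : 0 < K by rewrite divr_gt0//; lra.
pose M := 2 * K * (2 * pi) + 1.
have M0 : 0 < M by rewrite ltr_wpDl// mulr_ge0// mulr_ge0// ltW.
have [d d0 H] := cdifferentiable_continuous (fd (ltW zr)) (divr_gt0 e0 M0).
(* the contracted circle stays within s (2 r) of z, hence inside the d-ball *)
pose s := Num.min 1 (d / (4 * r)).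
have s0 : 0 < s by rewrite lt_min ltr01 divr_gt0//; lra.
have s1 : s <= 1 by rewrite ge_min lexx.
have sd : s * (2 * r) < d.
  have : s <= d / (4 * r) by rewrite ge_min lexx orbT.
  rewrite ler_pdivlMr; last lra.
  lra.
rewrite -(@star_integral_const s); last by rewrite s0.
rewrite -cintegralZl// -cintegralB; last 2 first.
- by move=> t _; apply: ccontinuousM (cauchy_kernel_ccontinuous _ zr);
    apply: Fc; rewrite s0.
- by move=> t _; apply: ccontinuousM (cauchy_kernel_ccontinuous _ zr);
    exact: ccontinuous_cst.
set I := cintegral _ _ _.
rewrite -(subr0 I) -(mul0r ((2 * pi - 0)%:C)%C).
apply: (@le_trans _ _ (2 * (e / M * K) * (2 * pi - 0))).
  apply: cintegral_approx => //.
    move=> t _; apply: ccontinuousB;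
      apply: ccontinuousM (cauchy_kernel_ccontinuous _ zr).
      by apply: Fc; rewrite s0.
    exact: ccontinuous_cst.
  move=> t _; rewrite subr0 -mulrBl cabsM ler_pM ?cabs_ge0//; last first.
    exact: cauchy_kernel_le.
  apply: H; rewrite /star_path addrC addKr cabsM cabs_real gtr0_norm//.
  apply: le_lt_trans sd; rewrite ler_pM2l//.
  by rewrite (le_trans (cabsB _ _))// circle_pt_cabs; lra.
rewrite subr0 (_ : _ * _ = e * ((M - 1) / M)).
  by rewrite ger_pMr// ler_pdivrMr//; lra.
have -> : M - 1 = 2 * K * (2 * pi) by rewrite /M addrK.
by field; lra.
Qed.

End cauchy.

(** Cauchy's formula at the centre, where the kernel is the constant 'i. *)
Lemma mean_value (R : realType) (f : R[i] -> R[i]) (r : R) : 0 < r ->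
  (forall w, cabs w <= r -> cdifferentiable_at f w) ->
  cintegral 0 (2 * pi) (fun t => f (circle_pt r t)) = ((2 * pi)%:C)%C * f 0.
Proof.
move=> r0 fd; have z0 : cabs 0 < r by rewrite cabs0.
have i0 : 'i%C != 0 :> R[i] by rewrite eq_complex/= oner_eq0 andbF.
have kE t : cauchy_kernel r 0 t = 'i%C :> R[i].
  rewrite /cauchy_kernel subr0 mulfK//.
  by have := circle_pt_subr_neq0 t z0; rewrite subr0.
have fc : ccontinuous_on 0 (2 * pi) (fun t => f (circle_pt r t)).
  move=> t _; apply: ccontinuous_comp; last exact: circle_pt_ccontinuous.
  by apply: fd; rewrite circle_pt_cabs// ltW.
have := cauchy_formula z0 fd.
rewrite (@eq_cintegral _ _ _ _ (fun t => 'i%C * f (circle_pt r t))); last first.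
  by move=> t _; rewrite kE mulrC.
rewrite [in RHS](@eq_cintegral _ _ _ _ (fun=> 'i%C)); last by move=> t _.
rewrite cintegralZl// cintegral_cst ?subr0; last by rewrite mulr_ge0// pi_ge0.
by move=> H; apply: (mulfI i0); rewrite H; ring.
Qed.

(** The imaginary part of the kernel is Re (1 / (1 - u)) with
    u = z / circle_pt r t of modulus less than 1, hence at least 1/2. *)
Lemma cauchy_kernel_integral_ge (R : realType) (r : R) (z : R[i]) : cabs z < r ->
  pi <= cabs (cintegral 0 (2 * pi) (cauchy_kernel r z)).
Proof.
move=> zr; apply: le_trans (ger_Im_cabs _); apply: le_trans (ler_norm _) => /=.
have pi0 : 0 <= 2 * pi :> R by rewrite mulr_ge0// pi_ge0.
apply: (@le_trans _ _ (2^-1 * (2 * pi - 0))); first by rewrite subr0 mulKf.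
rewrite -segment_integral_cst//; apply: le_segment_integral.
- by move=> x _; exact: cvg_cst.
- by move=> x _; apply/continuous_Im/cauchy_kernel_ccontinuous.
move=> t _; rewrite /cauchy_kernel.
have r0 : 0 <= r by have := cabs_ge0 z; lra.
have ez := circle_pt_subr_neq0 t zr.
have := circle_pt_cabs t r0.
set e := circle_pt r t in ez *; move=> er.
have d0 := cabs_gt0 ez.
(* Im (i e / (e - z)) = Re (e * conj (e - z)) / |e - z|^2 *)
have -> : complex.Im ('i%C * e / (e - z)) =
  (complex.Re e * complex.Re (e - z) + complex.Im e * complex.Im (e - z)) /
  cabs (e - z) ^+ 2.
  rewrite sqr_cabs; case: e {er ez d0} => a b; case: z {zr} => c d /=.
  by ring.
rewrite ler_pdivlMr ?exprn_gt0// sqr_cabs.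
have : cabs z ^+ 2 < cabs e ^+ 2 by rewrite er ltr_pXn2r ?nnegrE ?cabs_ge0.
rewrite !sqr_cabs; case: e {er ez d0} => a b; case: z {zr} => c d /=.
lra.
Qed.

(** * Inner functions *)

Definition circle_moment (R : realType) (f : R[i] -> R[i]) (n : nat) (r : R) : R :=
  segment_integral 0 (2 * pi) (fun t => cabs (f (circle_pt r t)) ^+ n).

Lemma holomorphic_cdifferentiable (R : realType) (f : R[i] -> R[i]) (z : R[i]) :
  holomorphic_on_disk f -> cabs z < 1 -> cdifferentiable_at f z.
Proof. by move=> hf /hf; exact: derivable_cdifferentiable. Qed.

Lemma circle_pt_disk (R : realType) (r t : R) :
  0 <= r < 1 -> cabs (circle_pt r t) < 1.
Proof. by move=> /andP[r0 r1]; rewrite circle_pt_cabs. Qed.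

Lemma holomorphic_circle_ccontinuous (R : realType) (f : R[i] -> R[i]) (r : R) :
  holomorphic_on_disk f -> 0 <= r < 1 ->
  ccontinuous_on 0 (2 * pi) (fun t => f (circle_pt r t)).
Proof.
move=> hf r01 t _; apply: ccontinuous_comp; last exact: circle_pt_ccontinuous.
by apply: holomorphic_cdifferentiable => //; exact: circle_pt_disk.
Qed.

Lemma holomorphicM (R : realType) (f g : R[i] -> R[i]) :
  holomorphic_on_disk f -> holomorphic_on_disk g ->
  holomorphic_on_disk (fun z => f z * g z).
Proof. by move=> hf hg z z1; apply: derivableM; [exact: hf|exact: hg]. Qed.

Lemma holomorphic_cst (R : realType) (c : R[i]) : holomorphic_on_disk (fun=> c).
Proof. by move=> z _; exact: derivable_cst. Qed.

Lemma holomorphicX (R : realType) (f : R[i] -> R[i]) n :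
  holomorphic_on_disk f -> holomorphic_on_disk (fun z => f z ^+ n).
Proof.
move=> hf; elim: n => [|n IH]; first exact: holomorphic_cst.
by under eq_fun do rewrite exprS; exact: holomorphicM.
Qed.

Lemma continuous_on_exp (R : realType) (a b : R) (u : R -> R) n :
  continuous_on a b u -> continuous_on a b (fun t => u t ^+ n).
Proof.
move=> cu x xab; elim: n => [|n IH]; first exact: cvg_cst.
rewrite (_ : (fun t => _) = (fun t => u t * u t ^+ n)); last first.
  by apply/funext => t; rewrite exprS.
by apply: cvgM => //; exact: cu.
Qed.

Lemma continuous_on_cabs (R : realType) (a b : R) (u : R -> R[i]) :
  ccontinuous_on a b u -> continuous_on a b (fun t => cabs (u t)).
Proof. by move=> cu x /cu; exact: continuous_cabs. Qed.

(** The moments tend to 2 pi along radii r -> 1, by dominated convergence: the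
    boundary values have modulus 1 almost everywhere, and f is bounded. The
    interval [pi, 3 pi] is an arbitrary neighbourhood of the limit, independent
    of n. *)
Lemma inner_moments (R : realType) (f : R[i] -> R[i]) n (s : R) :
  inner_function f -> s < 1 ->
  exists2 r : R, (0 <= r < 1) && (s < r) & pi <= circle_moment f n r <= 3 * pi.
Proof.
move=> [hf [M fM] fb] s1.
have pi0 : 0 < 2 * pi :> R by rewrite mulr_gt0// pi_gt0.
pose r_ (m : nat) : R := 1 - m.+1%:R^-1.
have r_lt m : r_ m < 1 by rewrite /r_ ltrBlDr ltrDl invr_gt0.
have r_ge m : 0 <= r_ m by rewrite /r_ subr_ge0 invf_le1 ?ltr0n// ler1n.
have r_cvg : (r_ m @[m --> \oo] --> (1 : R))%classic.
  rewrite -[X in (_ --> X)%classic]subr0; apply: cvgB; first exact: cvg_cst.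
  exact: cvg_harmonic.
have M0 : 0 <= M by apply: le_trans (cabs_ge0 (f 0)) (fM _ _); rewrite cabs0.
have fc m : continuous_on 0 (2 * pi) (fun t => cabs (f (circle_pt (r_ m) t)) ^+ n).
  apply/continuous_on_exp/continuous_on_cabs/holomorphic_circle_ccontinuous => //.
  by rewrite r_ge r_lt.
have cc (c : R) : continuous_on 0 (2 * pi) (fun=> c).
  by move=> x _; exact: cvg_cst.
have mf m := measurable_int _ (continuous_on_integrable (fc m)).
have := @dominated_convergence _ _ R lebesgue_measure `[0, 2 * pi]%classic
  (measurable_itv _) (fun m t => (cabs (f (circle_pt (r_ m) t)) ^+ n)%:E)
  (fun=> 1%:E) (fun=> (M ^+ n)%:E) mf (measurable_cst _).
case.
- move: fb; apply: filterS.
    exact: (ae_filter_ringOfSetsType (@lebesgue_measure R)).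
  move=> t H tI; have [l fl l1] := H tI.
  apply: cvg_EFin; first exact: nearW.
  rewrite -[X in (_ --> X)%classic](expr1n _ n) -l1.
  apply: (@cvg_comp _ _ _ (fun m => cabs (f (circle_pt (r_ m) t)))
    (fun x => x ^+ n) _ (nbhs (cabs l))); last exact: exprn_continuous.
  apply/cvgrPdist_le => e e0.
  have : (\forall r \near (1 : R)^'-, cabs (f (circle_pt r t) - l) <= e)%classic.
    have eC : 0 < (e%:C)%C by rewrite ltcR.
    move/cvgrPdist_le : fl => /(_ _ eC).
    by apply: filterS => r; rewrite normcE_cabs lecR cabsC.
  rewrite near_withinE => -[d /= d0 Hd].
  move/cvgrPdist_lt : r_cvg => /(_ _ d0); apply: filterS => m rm.
  by rewrite (le_trans (ler_dist_cabs _ _))// cabsC Hd.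
- exact: continuous_on_integrable (cc _).
- apply: aeW => t m _ /=; rewrite lee_fin ger0_norm ?exprn_ge0 ?cabs_ge0//.
  rewrite lerXn2r ?nnegrE ?cabs_ge0// fM// circle_pt_disk//.
  by rewrite r_ge r_lt.
move=> _ _; rewrite integral_cst//= lebesgue_measure_itv/= lte_fin pi0 mul1e.
rewrite -EFinD subr0.
have IE m : (\int[lebesgue_measure]_(x in `[0%R, (2 * pi)%R])
    (cabs (f (circle_pt (r_ m) x)) ^+ n)%:E)%E = (circle_moment f n (r_ m))%:E.
  by rewrite /circle_moment /segment_integral /Rintegral fineK//;
    exact/integrable_fin_num/continuous_on_integrable.
under eq_fun do rewrite IE.
move=> /fine_cvgP[_ /cvgrPdist_le /(_ pi (pi_gt0 R))] /= H1.
move/cvgrPdist_lt : r_cvg => /(_ (1 - s)); rewrite subr_gt0 => /(_ s1) H2.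
near (\oo)%classic => m; exists (r_ m).
  rewrite r_ge r_lt/=.
  have : `|1 - r_ m| < 1 - s by near: m.
  by have := ler_norm (1 - r_ m); lra.
have : `|2 * pi - circle_moment f n (r_ m)| <= pi by near: m.
by rewrite ler_norml => /andP[h1 h2]; apply/andP; split; lra.
Unshelve. all: by end_near. Qed.

(** Cauchy's formula for f^n bounds |f z|^n by a constant that does not depend
    on n, because the moments of f on suitable circles do not grow with n. The
    powers of a number greater than 1 are unbounded. *)
Lemma inner_function_le1 (R : realType) (f : R[i] -> R[i]) (z : R[i]) :
  inner_function f -> cabs z < 1 -> cabs (f z) <= 1.
Proof.
move=> fi z1; have [hf _ _] := fi; have z0 := cabs_ge0 z.
have pi0 := pi_gt0 R.
(* 12 pi / (1 - |z|) = 2 * (2 / (1 - |z|)) * (3 pi): the factor of the integral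
   bound, the bound of the kernel for r >= (1 + |z|) / 2, and that of the moment *)
pose C : R := 12 / (1 - cabs z).
have bnd n : cabs (f z) ^+ n <= C.
  have rho1 : (1 + cabs z) / 2 < 1 by lra.
  have [r /andP[/andP[r0 r1] rr] /andP[_ Sr]] := inner_moments n fi rho1.
  have zr : cabs z < r by lra.
  have fnd w : cabs w <= r -> cdifferentiable_at (fun z => f z ^+ n) w.
    move=> wr; apply: holomorphic_cdifferentiable; first exact: holomorphicX.
    exact: le_lt_trans r1.
  have r01 : 0 <= r < 1 by rewrite r0.
  have fc := holomorphic_circle_ccontinuous (holomorphicX (n := n) hf) r01.
  have kc : ccontinuous_on 0 (2 * pi) (cauchy_kernel r z).
    by move=> t _; exact: cauchy_kernel_ccontinuous.
  have fkc : ccontinuous_on 0 (2 * pi)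
      (fun t => f (circle_pt r t) ^+ n * cauchy_kernel r z t).
    by move=> t tI; exact: ccontinuousM (fc t tI) (kc t tI).
  have := le_cabs_cintegral fkc; rewrite (cauchy_formula zr fnd) cabsM cabsX.
  have := cauchy_kernel_integral_ge zr.
  set I := cabs (cintegral _ _ _) => Ipi.
  have cfn : continuous_on 0 (2 * pi) (fun t => cabs (f (circle_pt r t)) ^+ n).
    by apply/continuous_on_exp/continuous_on_cabs/holomorphic_circle_ccontinuous.
  have : segment_integral 0 (2 * pi)
      (fun t => cabs (f (circle_pt r t) ^+ n * cauchy_kernel r z t)) <=
      2 / (1 - cabs z) * (3 * pi).
    apply: (@le_trans _ _ (2 / (1 - cabs z) * circle_moment f n r)); last first.
      by rewrite ler_wpM2l// divr_ge0//; lra.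
    rewrite /circle_moment -segment_integralZl//.
    apply: le_segment_integral; first exact: continuous_on_cabs.
      by move=> t tI; apply: cvgMr; exact: cfn.
    move=> t _; rewrite cabsM cabsX mulrC ler_wpM2r ?exprn_ge0 ?cabs_ge0//.
    rewrite (le_trans (cauchy_kernel_le t zr))//.
    rewrite -[2 / _]invf_div -[leRHS]mul1r ler_pM ?invr_ge0 ?(ltW r1)//; [lra|].
    by rewrite lef_pV2 ?posrE; lra.
  move=> h1 h2.
  have h3 : cabs (f z) ^+ n * pi <= cabs (f z) ^+ n * I.
    by rewrite ler_wpM2l// exprn_ge0// cabs_ge0.
  rewrite -(ler_pM2r pi0) /C.
  have -> : 12 / (1 - cabs z) * pi = 2 * (2 / (1 - cabs z) * (3 * pi)) by ring.
  lra.
rewrite leNgt; apply/negP => f1.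
have C0 : 0 < C by rewrite divr_gt0//; lra.
have [n nC] : exists n : nat, C < n%:R * (cabs (f z) - 1).
  exists (Num.truncn (C / (cabs (f z) - 1))).+1.
  by rewrite -ltr_pdivrMr ?truncnS_gt//; lra.
have : 1 + n%:R * (cabs (f z) - 1) <= cabs (f z) ^+ n.
  elim: n {nC} => [|n IH]; first by rewrite mul0r addr0 expr0.
  rewrite exprS -(@ler_pM2l _ (cabs (f z))) in IH *; last lra.
  apply: le_trans IH; rewrite -natr1.
  have : 0 <= n%:R * (cabs (f z) - 1) * (cabs (f z) - 1).
    by rewrite !mulr_ge0//; lra.
  lra.
by have := bnd n; lra.
Qed.

(** * Integral means *)

(** The tangent inequality at two points gives a local Lipschitz bound for
    s^p on s >= 0, including at s = 0. *)
Lemma continuous_powR_comp (R : realType) (p : R) (u : R -> R) (x : R) :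
  1 < p -> (forall t, 0 <= u t) -> {for x, continuous u} ->
  {for x, continuous (fun t => u t `^ p)}.
Proof.
move=> p1 u0 cu; apply/cvgrPdist_le => /= e e0.
pose L := p * (u x + 1) `^ (p - 1).
have L0 : 0 < L by rewrite mulr_gt0 ?powR_gt0//; have := u0 x; lra.
have m0 : 0 < Num.min 1 (e / L) by rewrite lt_min ltr01 divr_gt0.
move/cvgrPdist_le : cu => /(_ _ m0); apply: filterS => t.
rewrite le_min ler_pdivlMr// => /andP[h1 h2].
have ut : u t <= u x + 1 by have := ler_norm (u t - u x); rewrite distrC; lra.
have lip s : 0 <= s <= u x + 1 -> p * s `^ (p - 1) <= L.
  move=> /andP[s0 s1]; rewrite ler_wpM2l ?ge0_ler_powR ?nnegrE//; last 3 first.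
  - by have := u0 x; lra.
  - lra.
  - lra.
have bd s w : 0 <= s <= u x + 1 -> 0 <= w -> s `^ p - w `^ p <= L * `|s - w|.
  move=> sI w0; have [s0 _] := andP sI.
  have h := powR_tangent p1 s0 w0; have sL := lip _ sI.
  apply: (@le_trans _ _ (p * s `^ (p - 1) * (s - w))); first lra.
  apply: (@le_trans _ _ (p * s `^ (p - 1) * `|s - w|)).
    by rewrite ler_wpM2l ?ler_norm// mulr_ge0 ?powR_ge0//; lra.
  by rewrite ler_wpM2r.
have tI : 0 <= u t <= u x + 1 by rewrite u0.
have xI : 0 <= u x <= u x + 1 by rewrite u0; lra.
have := bd _ _ xI (u0 t); have := bd _ _ tI (u0 x).
rewrite [`|u t - u x|]distrC => b1 b2; rewrite ler_norml.
by apply/andP; split; lra.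
Qed.

Lemma integral_mean_circle (R : realType) (p : R) (F : R[i] -> R[i]) (r : R) :
  1 < p -> ccontinuous_on 0 (2 * pi) (fun t => F (circle_pt r t)) ->
  integral_mean p F r = ((2 * pi)^-1 *
    segment_integral 0 (2 * pi) (fun t => cabs (F (circle_pt r t)) `^ p))%:E.
Proof.
move=> p1 Fc; rewrite /integral_mean EFinM; congr (_ * _)%E.
rewrite /segment_integral /Rintegral fineK//.
apply/integrable_fin_num/continuous_on_integrable => // t tI.
apply: continuous_powR_comp => // [s|]; first exact: cabs_ge0.
exact: continuous_on_cabs Fc _ tI.
Qed.

Lemma integral_mean_ge0 (R : realType) (p : R) (F : R[i] -> R[i]) (r : R) :
  (0 <= integral_mean p F r)%E.
Proof.
apply: mule_ge0; first by rewrite lee_fin invr_ge0 mulr_ge0// pi_ge0.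
by apply: integral_ge0 => t _; rewrite lee_fin powR_ge0.
Qed.

(** Transfers optimality, which compares suprema of means, to a bound for each
    single mean. *)
Lemma Hp_norm_compare (R : realType) (p X : R) (F G : R[i] -> R[i]) : 0 < p ->
  (Hp_norm p F <= Hp_norm p G)%E ->
  (forall r : R, 0 <= r < 1 -> (integral_mean p G r <= X%:E)%E) ->
  forall r : R, 0 <= r < 1 -> (integral_mean p F r <= X%:E)%E.
Proof.
move=> p0; rewrite /Hp_norm.
set SF := ereal_sup _; set SG := ereal_sup _ => SFG GX r r01.
have SF_ge s : 0 <= s < 1 -> (integral_mean p F s <= SF)%E.
  by move=> s01; apply: ereal_sup_ubound; exists s.
have SG_ge0 : (0 <= SG)%E.
  apply: (le_trans (integral_mean_ge0 p G 0)).
  by apply: ereal_sup_ubound; exists 0 => //=; rewrite lexx ltr01.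
have SF_ge0 : (0 <= SF)%E.
  by apply: le_trans (integral_mean_ge0 p F r) (SF_ge _ r01).
have SGX : (SG <= X%:E)%E by apply: ge_ereal_sup => _ [s s01 <-]; exact: GX.
have powK S : (0 <= S)%E -> ((S `^ p^-1) `^ p)%E = S.
  by move=> S0; rewrite -poweRrM mulVf ?gt_eqF// poweRe1.
apply: le_trans (SF_ge _ r01) _; apply: le_trans SGX.
rewrite -(powK SF SF_ge0) -(powK SG SG_ge0).
by apply: gt0_ler_poweR => //; rewrite ?in_itv/= ?poweR_ge0 ?leey// ltW.
Qed.

Lemma circle_mean_holomorphic (R : realType) (h : R[i] -> R[i]) (r : R) :
  holomorphic_on_disk h -> 0 <= r < 1 ->
  segment_integral 0 (2 * pi) (fun t => complex.Re (h (circle_pt r t))) =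
  2 * pi * complex.Re (h 0).
Proof.
move=> hh /andP[]; rewrite le_eqVlt => /predU1P[<- _|r0 r1].
  rewrite /circle_pt; under eq_fun do rewrite !mul0r.
  by rewrite segment_integral_cst ?mulr_ge0 ?pi_ge0// subr0 mulrC.
have := @mean_value _ h r r0 (fun w wr => holomorphic_cdifferentiable hh
  (le_lt_trans wr r1)).
move=> /(congr1 (@complex.Re R)); rewrite /cintegral/= => ->.
by case: (h 0) => x y /=; rewrite mul0r subr0.
Qed.

(** The integrands that occur in both error estimates are affine in Re h and
    |f|^2; their circle means are known from the mean value property. *)
Lemma circle_mean_affine (R : realType) (h f : R[i] -> R[i]) (r c0 q k : R) :
  holomorphic_on_disk h -> holomorphic_on_disk f -> 0 <= r < 1 ->
  let u t := c0 + q * complex.Re (h (circle_pt r t))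
             + k * cabs (f (circle_pt r t)) ^+ 2 in
  continuous_on 0 (2 * pi) u /\
  (2 * pi)^-1 * segment_integral 0 (2 * pi) u =
    c0 + q * complex.Re (h 0) + k * (circle_moment f 2 r / (2 * pi)).
Proof.
move=> hh hf r01 u; rewrite /u {u}.
have c1 : continuous_on 0 (2 * pi) (fun=> c0) by move=> x _; exact: cvg_cst.
have ch : continuous_on 0 (2 * pi) (fun t => complex.Re (h (circle_pt r t))).
  by move=> t tI; apply/continuous_Re/holomorphic_circle_ccontinuous.
have cf : continuous_on 0 (2 * pi) (fun t => cabs (f (circle_pt r t)) ^+ 2).
  by apply/continuous_on_exp/continuous_on_cabs/holomorphic_circle_ccontinuous.
have cZ (c : R) (g : R -> R) : continuous_on 0 (2 * pi) g ->
    continuous_on 0 (2 * pi) (fun t => c * g t).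
  by move=> cg x xab; apply: cvgMr; exact: cg.
have cD (g1 g2 : R -> R) : continuous_on 0 (2 * pi) g1 -> continuous_on 0 (2 * pi) g2 ->
    continuous_on 0 (2 * pi) (fun t => g1 t + g2 t).
  by move=> cg1 cg2 x xab; apply: cvgD; [exact: cg1|exact: cg2].
have pi0 := pi_gt0 R.
have cu := cD _ _ (cD _ _ c1 (cZ q _ ch)) (cZ k _ cf).
split => //; rewrite (segment_integralD (cD _ _ c1 (cZ q _ ch)) (cZ k _ cf)).
rewrite (segment_integralD c1 (cZ q _ ch)) !segment_integralZl//.
rewrite segment_integral_cst; last lra.
rewrite circle_mean_holomorphic// subr0 -/(circle_moment f 2 r).
by field; lra.
Qed.

Lemma integral_mean_le (R : realType) (p c0 q r : R) (h : R[i] -> R[i]) :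
  1 < p -> holomorphic_on_disk h -> 0 <= r < 1 ->
  (forall z, cabs z < 1 -> cabs (1 + h z) `^ p <= c0 + q * complex.Re (h z)) ->
  (integral_mean p (fun z => (1 + h z)%R) r <= (c0 + q * complex.Re (h 0))%:E)%E.
Proof.
move=> p1 hh r01 H.
have Fc : ccontinuous_on 0 (2 * pi) (fun t => 1 + h (circle_pt r t)).
  move=> t tI; apply: ccontinuousD; first exact: ccontinuous_cst.
  exact: holomorphic_circle_ccontinuous tI.
rewrite (integral_mean_circle p1 Fc) lee_fin.
have [cu] := @circle_mean_affine R h (fun=> 0) r c0 q 0 hh (@holomorphic_cst R 0) r01.
rewrite [0 * (_ / _)]mul0r addr0 => <-; rewrite ler_wpM2l ?invr_ge0 ?mulr_ge0 ?pi_ge0//.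
apply: le_segment_integral => //.
  move=> t tI; apply: continuous_powR_comp => // [s|]; first exact: cabs_ge0.
  exact: continuous_on_cabs Fc _ tI.
by move=> t _; rewrite mul0r addr0; apply: H; exact: circle_pt_disk.
Qed.

Lemma integral_mean_ge (R : realType) (p c0 q k r : R) (h f : R[i] -> R[i]) :
  1 < p -> holomorphic_on_disk h -> holomorphic_on_disk f -> 0 <= r < 1 ->
  (forall t, let z := circle_pt r t in
    c0 + q * complex.Re (h z) + k * cabs (f z) ^+ 2 <= cabs (1 + h z) `^ p) ->
  ((c0 + q * complex.Re (h 0) + k * (circle_moment f 2 r / (2 * pi)))%:E
    <= integral_mean p (fun z => (1 + h z)%R) r)%E.
Proof.
move=> p1 hh hf r01 H.
have Fc : ccontinuous_on 0 (2 * pi) (fun t => 1 + h (circle_pt r t)).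
  move=> t tI; apply: ccontinuousD; first exact: ccontinuous_cst.
  exact: holomorphic_circle_ccontinuous tI.
rewrite (integral_mean_circle p1 Fc) lee_fin.
have [cu <-] := circle_mean_affine c0 q k hh hf r01.
rewrite ler_wpM2l ?invr_ge0 ?mulr_ge0 ?pi_ge0//.
apply: le_segment_integral => //.
move=> t tI; apply: continuous_powR_comp => // [s|]; first exact: cabs_ge0.
exact: continuous_on_cabs Fc _ tI.
Qed.

(** * The two error estimates *)

(** The competitor is q = - l with l = - e (conj (f 0)). The linear term of the
    error is then - p e |f 0|^2 and the quadratic one at most K e^2 |f 0|^2,
    where e is chosen so small that the former dominates. *)
Lemma constant_error_le (R : realType) (p : R) : 1 < p ->
  exists2 b : R, 0 < b & forall f : R[i] -> R[i],
    holomorphic_on_disk f -> (forall z, cabs z < 1 -> cabs (f z) <= 1) ->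
    exists l : R[i], forall r : R, 0 <= r < 1 ->
      (integral_mean p (fun z => (1 + l * f z)%R) r
        <= (1 - b * cabs (f 0) ^+ 2)%:E)%E.
Proof.
move=> p1; have [K K0 HK] := cabs_powR_le p1.
pose e := Num.min 2^-1 (p / (2 * K)).
have e0 : 0 < e by rewrite lt_min invr_gt0 ltr0n divr_gt0//; lra.
have e2 : e <= 2^-1 by rewrite ge_min lexx.
have eK : K * e <= p / 2.
  have : e <= p / (2 * K) by rewrite ge_min lexx orbT.
  by rewrite ler_pdivlMr; lra.
exists (p * e / 2) => [|f hf f1]; first by rewrite divr_gt0// mulr_gt0//; lra.
set c := f 0; have c1 : cabs c <= 1 by apply: f1; rewrite cabs0.
have c0 := cabs_ge0 c.
pose l := - ((e%:C)%C * (c^*)%C).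
have cconj : cabs (c^*)%C = cabs c by rewrite /cabs; case: (c) => x y /=; rewrite sqrrN.
have lE : cabs l = e * cabs c by rewrite cabsN cabsM cabs_real gtr0_norm// cconj.
have lc : complex.Re (l * c) = - (e * cabs c ^+ 2).
  by rewrite sqr_cabs /l; case: (c) => x y /=; ring.
exists l => r r01.
have := @integral_mean_le R p (1 + K * cabs l ^+ 2) p r (fun z => l * f z) p1.
rewrite -/c lc lE => H; apply: le_trans (H _ r01 _) _.
- exact: (holomorphicM (@holomorphic_cst R l) hf).
- move=> z z1; have lf : cabs (l * f z) <= e * cabs c.
    by rewrite cabsM lE ler_piMr ?f1// mulr_ge0// ltW.
  have ec : e * cabs c <= 2^-1.
    have : e * cabs c <= e by rewrite ger_pMr.
    lra.
  have := HK (l * f z); have := cabsD 1 (l * f z); have := cabsB (1 + l * f z) (l * f z).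
  rewrite addrK cabs1 => h1 h2 /(_ _).
  move=> /(_ ltac:(apply/andP; split; lra)) h3; apply: (le_trans h3).
  have : K * cabs (l * f z) ^+ 2 <= K * (e * cabs c) ^+ 2.
    by rewrite ler_pM2l// lerXn2r ?nnegrE ?cabs_ge0// mulr_ge0// ltW.
  lra.
rewrite lee_fin.
have : (K * e) * (e * cabs c ^+ 2) <= p / 2 * (e * cabs c ^+ 2).
  by rewrite ler_wpM2r// mulr_ge0 ?sqr_ge0// ltW.
lra.
Qed.

(** The quadratic lower bound for |1 + h|^p needs |h| bounded, so |a| is first
    bounded, using that the error is at most 1 and that
    |1 + h|^p >= 1 + p (|h| - 2) without restriction on h. On a circle of radius
    r > 3/4 with |w| <= 1/4, the factor |z - w| lies between 1/2 and 5/4. *)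
Lemma linear_error_ge (R : realType) (p : R) : 1 < p ->
  exists2 k : R, 0 < k & forall (f : R[i] -> R[i]) (a w : R[i]),
    inner_function f -> cabs w <= 4^-1 ->
    (forall r : R, 0 <= r < 1 ->
      (integral_mean p (fun z => (1 + - (a * (z - w) * f z))%R) r <= 1%:E)%E) ->
    exists2 r : R, 0 <= r < 1 &
      ((1 - p * (cabs a * cabs w * cabs (f 0)) + k * cabs a ^+ 2)%:E <=
      integral_mean p (fun z => (1 + - (a * (z - w) * f z))%R) r)%E.
Proof.
move=> p1; (* 11 = 1 + 8 * (5 / 4) bounds |1 + h|, once |a| <= 8 is known *)
have [k k0 Hk] := @cabs_powR_ge R p 11 p1 ltac:(lra).
exists (k / 8) => [|f a w fi w4 err1]; first by rewrite divr_gt0.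
have [hf _ _] := fi; have pi0 := pi_gt0 R.
have q1 : 3 / 4 < 1 :> R by lra.
have [r /andP[r01 rr] /andP[Sr _]] := inner_moments 2 fi q1.
have [r0 r1] := andP r01.
pose h z := - (a * (z - w) * f z).
have hh : holomorphic_on_disk h.
  move=> z z1; apply: derivableN; apply: derivableM; last exact: hf.
  apply: derivableM; first exact: derivable_cst.
  by apply: derivableB; [exact: derivable_id|exact: derivable_cst].
have f1 t : cabs (f (circle_pt r t)) <= 1.
  by apply: inner_function_le1 => //; exact: circle_pt_disk.
have zw t : 2^-1 <= cabs (circle_pt r t - w) <= 5 / 4.
  have := cabsB (circle_pt r t) w; have := cabsD (circle_pt r t - w) w.
  by rewrite subrK circle_pt_cabs// => *; apply/andP; split; lra.
have hE t : cabs (h (circle_pt r t)) =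
    cabs a * cabs (circle_pt r t - w) * cabs (f (circle_pt r t)).
  by rewrite /h cabsN !cabsM.
set S := circle_moment f 2 r in Sr.
have S2 : 2^-1 <= S / (2 * pi) by rewrite ler_pdivlMr; lra.
have a0 := cabs_ge0 a.
have ha t : 2^-1 * cabs a * cabs (f (circle_pt r t)) <= cabs (h (circle_pt r t)).
  have /andP[z1 z2] := zw t.
  rewrite hE ler_wpM2r ?cabs_ge0// mulrC ler_wpM2l//.
(* the error is at most 1, so the mean of |h| is at most 2, and it is at least
   |a| / 4 *)
have a8 : cabs a <= 8.
  have Hb t : let z := circle_pt r t in
     1 - 2 * p + 0 * complex.Re (h z) + p * (2^-1 * cabs a) * cabs (f z) ^+ 2 <=
     cabs (1 + h z) `^ p.
    set z := circle_pt r t; lazy zeta.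
    have := powR_tangent p1 ler01 (cabs_ge0 (1 + h z)).
    rewrite !powR1 mulr1; apply: le_trans.
    have := cabsB (1 + h z) 1; rewrite addrAC subrr add0r cabs1 => h1.
    have h2 := ha t; rewrite -/z in h2.
    have h3 : cabs (f z) ^+ 2 <= cabs (f z) by rewrite expr2 ler_piMr ?cabs_ge0 ?f1.
    have h4 : 2^-1 * cabs a * cabs (f z) ^+ 2 <= cabs (1 + h z) + 1.
      apply: le_trans h1; apply: le_trans h2.
      by rewrite ler_wpM2l// mulr_ge0// invr_ge0.
    have h5 : p * (2^-1 * cabs a * cabs (f z) ^+ 2) <= p * (cabs (1 + h z) + 1).
      by rewrite ler_pM2l//; lra.
    lra.
  have := le_trans (integral_mean_ge p1 hh hf r01 Hb) (err1 _ r01).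
  rewrite lee_fin mul0r addr0 -/S => h1.
  have h2 : p * (2^-1 * cabs a) * 2^-1 <= p * (2^-1 * cabs a) * (S / (2 * pi)).
    by rewrite ler_wpM2l// mulr_ge0 ?mulr_ge0//; lra.
  have h3 : p * cabs a <= p * 8 by lra.
  by rewrite ler_pM2l in h3; lra.
exists r => //.
have Hb t : let z := circle_pt r t in
    1 + p * complex.Re (h z) + k * (4^-1 * cabs a ^+ 2) * cabs (f z) ^+ 2 <=
    cabs (1 + h z) `^ p.
  set z := circle_pt r t; lazy zeta; have h1 := ha t; rewrite -/z in h1.
  have hz : cabs (1 + h z) <= 11.
    have /andP[z1 z2] := zw t; have f1t := f1 t.
    rewrite (le_trans (cabsD _ _))// cabs1 /z hE.
    have : cabs a * cabs (circle_pt r t - w) <= 8 * (5 / 4) by rewrite ler_pM ?cabs_ge0.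
    have : cabs a * cabs (circle_pt r t - w) * cabs (f (circle_pt r t)) <=
       cabs a * cabs (circle_pt r t - w) by rewrite ler_piMr// mulr_ge0 ?cabs_ge0.
    lra.
  apply: le_trans (Hk _ hz); rewrite lerD2l -mulrA ler_pM2l//.
  have -> : 4^-1 * cabs a ^+ 2 * cabs (f z) ^+ 2 = (2^-1 * cabs a * cabs (f z)) ^+ 2.
    by rewrite !exprMn; congr (_ * _ * _); lra.
  by rewrite lerXn2r ?nnegrE ?mulr_ge0 ?cabs_ge0// invr_ge0.
apply: le_trans (integral_mean_ge p1 hh hf r01 Hb).
rewrite lee_fin -/S.
have h0 : - (cabs a * cabs w * cabs (f 0)) <= complex.Re (h 0).
  have := ger_Re_cabs (h 0); rewrite /h sub0r cabsN !cabsM cabsN.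
  by rewrite ler_norml => /andP[].
have h2 : k * (4^-1 * cabs a ^+ 2) * 2^-1 <= k * (4^-1 * cabs a ^+ 2) * (S / (2 * pi)).
  by rewrite ler_wpM2l// mulr_ge0 ?mulr_ge0 ?sqr_ge0// ?ltW// invr_ge0.
have h3 : p * - (cabs a * cabs w * cabs (f 0)) <= p * complex.Re (h 0).
  by rewrite ler_pM2l//; lra.
lra.
Qed.

Unset Implicit Arguments.
Set Strict Implicit.
Set Printing Implicit Defensive.

Theorem theorem5p13 (R : realType) (p : R) (hp : 1 < p) :
  exists2 rho : R, 0 < rho &
    forall f : R[i] -> R[i],
      in_Hp p f -> inner_function f -> f 0 <> 0 ->
      forall a w : R[i],
        is_opa 1 p f (a *: ('X - w%:P)) -> rho <= cabs w.
Proof.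
have [b b0 Hb] := constant_error_le hp.
have [k k0 Hk] := linear_error_ge hp.
pose m := Num.min b k.
have m0 : 0 < m by rewrite lt_min b0.
exists (Num.min 4^-1 (2 * m / p)); first by rewrite lt_min invr_gt0 ltr0n divr_gt0//; lra.
move=> f _ fi f0 a w [_ opt]; have [hf _ _] := fi.
have f1 z : cabs z < 1 -> cabs (f z) <= 1 by exact: inner_function_le1.
have [l Hl] := Hb f hf f1.
set c := f 0 in f0 Hl; have c0 : 0 < cabs c by apply: cabs_gt0; exact/eqP.
have size_l : (size ((- l)%:P : {poly R[i]}) <= 2)%N.
  by rewrite (leq_trans (size_polyC_leq1 _)).
have cmp : (Hp_norm p (fun z => (1 + - (a * (z - w) * f z))%R)
            <= Hp_norm p (fun z => (1 + l * f z)%R))%E.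
  have := opt _ size_l; rewrite /opa_error.
  under eq_fun do rewrite hornerZ hornerXsubC.
  by under [X in (_ <= Hp_norm _ X)%E -> _]eq_fun do rewrite hornerC mulNr opprK.
have p0 : 0 < p by lra.
have up := Hp_norm_compare p0 cmp Hl.
rewrite ge_min; have [//|w4] /= := leP 4^-1 (cabs w).
have err1 r : 0 <= r < 1 ->
    (integral_mean p (fun z => (1 + - (a * (z - w) * f z))%R) r <= 1%:E)%E.
  move=> r01; apply: le_trans (up _ r01) _.
  by rewrite lee_fin gerBl mulr_ge0// ?sqr_ge0// ltW.
have [r r01 low] := Hk f a w fi (ltW w4) err1.
have := le_trans low (up _ r01); rewrite lee_fin -/c => h.
rewrite ler_pdivrMr//.
have a0 := cabs_ge0 a; have w0 := cabs_ge0 w.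
have hb : m * cabs c ^+ 2 <= b * cabs c ^+ 2.
  by rewrite ler_wpM2r ?sqr_ge0// ge_min lexx.
have hk : m * cabs a ^+ 2 <= k * cabs a ^+ 2.
  by rewrite ler_wpM2r ?sqr_ge0// ge_min lexx orbT.
pose Q := cabs a ^+ 2 + cabs c ^+ 2.
have Q0 : 0 < Q by rewrite ltr_wpDl ?sqr_ge0// exprn_gt0.
have ac : p * cabs w * (2 * (cabs a * cabs c)) <= p * cabs w * Q.
  rewrite ler_wpM2l ?mulr_ge0//; first exact: ltW.
  by rewrite /Q; have := sqr_ge0 (cabs a - cabs c); lra.
have mQ : m * Q <= p * (cabs a * cabs w * cabs c) by rewrite /Q; lra.
by rewrite -(ler_pM2r Q0); lra.
Qed.
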